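(* For every real $q$ with $|q|<1$, $$V^3(q)=V(q^3)\,\frac{1-V(q^3)+V^2(q^3)}{1+2V(q^3)+4V^2(q^3)}.$$
   Context: Ramanujan's cubic continued fraction is $$V(q)=\cfrac{q^{1/3}}{1+\cfrac{q+q^2}{1+\cfrac{q^2+q^4}{1+\cdots}}},\qquad |q|<1,$$ the $n$-th partial numerator after the first being $q^n+q^{2n}$, and $q^{1/3}$ denoting the real cube root of $q$ (so $V(q^3)=q\cdot(\text{continued fraction part at }q^3)$). *)

(* Defs.v *)
From Stdlib Require Import Reals.
From Coquelicot Require Import Coquelicot.
Open Scope R_scope.

Definition cbrt (x : R) : R :=
  if Rlt_dec 0 x then Rpower x (1/3)
  else if Rlt_dec x 0 then - Rpower (- x) (1/3) else 0.

Definition cf_num (q : R) (k : nat) : R := q ^ k + q ^ (2 * k).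

(* cf_tail q n k = 1 + a_k/(1 + a_(k+1)/( ... (1 + a_(k+n-1)/1))),
   i.e. the tail starting at index k truncated after depth n. *)
Fixpoint cf_tail (q : R) (n k : nat) : R :=
  match n with
  | O => 1
  | S n' => 1 + cf_num q k / cf_tail q n' (S k)
  end.

Definition cf_conv (q : R) (n : nat) : R := / cf_tail q n 1.

Definition cf_value (q : R) : R := real (Lim_seq (cf_conv q)).

(* Ramanujan's cubic continued fraction V(q) = q^(1/3) * (continued fraction). *)
Definition V (q : R) : R := cbrt q * cf_value q.

(* Main.v *)
Require Import Defs.
From Stdlib Require Import Reals Lra Lia.
From Coquelicot Require Import Coquelicot.
Open Scope R_scope.

(* Let a_k = q^k + q^(2k). The recurrence F(X) = F(Xq) + Xq(1 + Xq) F(Xq^2) has the solution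
   F(X) = S(X)/(Xq; q)_oo, where S is an explicit very-well-poised series with S(0) = 1, and
   the quotients F(q^k)/F(q^(k+1)) are the tails of the continued fraction. At X = 1 and
   X = q the series S collapses to theta series, so the continued fraction equals
   f(-q,-q^5)/phi(-q^3).

   Sorting the exponents of phi(-c) = sum (-1)^n c^(n^2) modulo 3 gives
   phi(-c) = phi(-c^9) - 2c f(-c^3,-c^15). Replacing c by each of its three products with
   cube roots of unity and multiplying, Gauss's product for phi yields
   phi(-c^9)^3 - 8c^3 f(-c^3,-c^15)^3 = phi(-c^3)^4/phi(-c^9). The theorem is an algebraic
   consequence of the trisection at c = q and of this identity at c = q and c = q^(1/3). *)

(** For negative [q] the partial numerators can be negative, so it is not immediate that the tails
    stay away from 0. This rests on a coincidence of constants: y + y^2 >= -1/4 for real y, and 1/2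
    is the double fixed point of x -> 1 - 1/(4x). Hence 1/2 is a lower bound for truncated and
    limiting tails alike, and the same argument shows that phi(-q^3) does not vanish.

    F itself is never formed: in F(q^k)/F(q^(k+1)) the infinite products cancel down to 1/(1 -
    q^(k+1)), so S alone suffices. Gauss's product needs no infinite product either: partial sums
    and partial products are shown to differ by a null sequence, so the products inherit the limit
    of the sums, and the multiplication over cube roots of unity is an identity between finite
    products. Both functional equations are proved for truncated sums with a closed-form remainder,
    so no infinite series is rearranged. Complex numbers enter only through the cube roots of unity;
    all theta values in the limits are real. *)

(** * Series, powers and a summability criterion *)

Lemma is_lim_seq_partial_sums (a : nat -> R) :
  ex_series a -> is_lim_seq (sum_f_R0 a) (Series a).
Proof.
  intros Ha.
  apply is_lim_seq_ext with (sum_n a); [intros n; apply sum_n_Reals|].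
  exact (Series_correct a Ha).
Qed.

Lemma ex_series_Rmult (c : R) (a : nat -> R) :
  ex_series a -> ex_series (fun n => c * a n).
Proof. exact (@ex_series_scal_l R_AbsRing R_NormedModule c a). Qed.

Lemma pow_in_unit_interval (x : R) (n : nat) : 0 <= x <= 1 -> 0 <= x ^ n <= 1.
Proof.
  intros Hx; split; [apply pow_le; lra|].
  rewrite <- (pow1 n); apply pow_incr; lra.
Qed.

Lemma Rabs_pow_S_lt_1 (x : R) (n : nat) : Rabs x < 1 -> Rabs (x ^ S n) < 1.
Proof.
  intros H; rewrite <- RPow_abs; apply pow_lt_1_compat; [|lia].
  split; [apply Rabs_pos|exact H].
Qed.

Lemma one_minus_pow_gt_0 (b : R) (n : nat) : Rabs b < 1 -> 0 < 1 - b ^ S n.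
Proof. intros Hb; assert (H := Rabs_pow_S_lt_1 b n Hb); apply Rabs_def2 in H; lra. Qed.

Lemma one_minus_pow_neq_0 (b : R) (n : nat) : Rabs b < 1 -> 1 - b ^ S n <> 0.
Proof. intros Hb; assert (H := one_minus_pow_gt_0 b n Hb); lra. Qed.

Lemma sqr_lt_1 (x : R) : Rabs x < 1 -> 0 <= x ^ 2 < 1.
Proof. intros H; split; [apply pow2_ge_0|]; apply Rabs_def2 in H; nra. Qed.

Lemma sqr_le_1 (X : R) : Rabs X <= 1 -> 0 <= X ^ 2 <= 1.
Proof. intros H; split; [apply pow2_ge_0|]; apply Rabs_le_between in H; nra. Qed.

(** The general term is (rho^n K)^n, and rho^n K eventually drops below 1/2, so a geometric series
    dominates. Since the quadratic exponent beats every K^n, crude geometric bounds on the quotients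
    of q-factorials are enough everywhere below. *)
Lemma ex_series_pow_sqr (rho K : R) :
  0 <= rho < 1 -> 0 <= K -> ex_series (fun n => rho ^ (n * n) * K ^ n).
Proof.
  intros Hrho HK.
  assert (Hlim : is_lim_seq (fun n => rho ^ n * K) (0 * K)).
  { apply is_lim_seq_mult'; [|apply is_lim_seq_const].
    apply is_lim_seq_geom; rewrite Rabs_pos_eq; lra. }
  rewrite Rmult_0_l in Hlim.
  apply is_lim_seq_spec in Hlim.
  destruct (Hlim (mkposreal (1/2) ltac:(lra))) as [N HN]; simpl in HN.
  apply (ex_series_incr_n _ N).
  apply (@ex_series_le R_AbsRing R_CompleteNormedModule _ (fun n => (1/2) ^ n)).
  2: { exists (/ (1 - 1/2)); apply is_series_geom; rewrite Rabs_pos_eq; lra. }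
  intros n.
  specialize (HN (N + n)%nat ltac:(lia)).
  change (Rabs (rho ^ ((N + n) * (N + n)) * K ^ (N + n)) <= (1/2) ^ n).
  rewrite pow_mult, <- Rpow_mult_distr, <- RPow_abs.
  rewrite Rminus_0_r in HN.
  rewrite pow_add.
  assert (H0 := Rabs_pos (rho ^ (N + n) * K)).
  assert (Ha := pow_in_unit_interval (Rabs (rho ^ (N + n) * K)) N ltac:(lra)).
  assert (Hb : Rabs (rho ^ (N + n) * K) ^ n <= (1/2) ^ n) by (apply pow_incr; lra).
  assert (Hc : 0 <= Rabs (rho ^ (N + n) * K) ^ n) by (apply pow_le; lra).
  nra.
Qed.

(** * Convergence of the continued fraction *)

Lemma cf_num_lower (q : R) (k : nat) : - (1/4) <= cf_num q k.
Proof.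
  unfold cf_num; rewrite (Nat.mul_comm 2), pow_mult.
  generalize (q ^ k); intros y; assert (H := pow2_ge_0 (y + 1/2)); lra.
Qed.

(** The worst case a = -1/4, x = 1/2 gives equality, so the lower bound of [cf_num_lower] is exactly
    what the threshold 1/2 tolerates. *)
Lemma one_plus_div_ge (a x : R) : - (1/4) <= a -> 1/2 <= x -> 1/2 <= 1 + a / x.
Proof.
  intros Ha Hx.
  apply (Rmult_le_reg_r x); [lra|].
  replace ((1 + a / x) * x) with (x + a) by (field; lra).
  lra.
Qed.

Lemma cf_tail_ge (q : R) (n k : nat) : 1/2 <= cf_tail q n k.
Proof.
  revert k; induction n as [|n IH]; intros k; simpl; [lra|].
  apply one_plus_div_ge; [apply cf_num_lower|apply IH].
Qed.

Lemma is_lim_seq_pow_index (q : R) : Rabs q < 1 -> is_lim_seq (fun k => Rabs q ^ k) 0.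
Proof. intros hq; apply is_lim_seq_geom; rewrite Rabs_Rabsolu; exact hq. Qed.

Lemma is_lim_seq_small (u : nat -> R) (eps : R) :
  is_lim_seq u 0 -> 0 < eps -> exists K, forall k, (K <= k)%nat -> Rabs (u k) < eps.
Proof.
  intros Hu Heps; apply is_lim_seq_spec in Hu.
  destruct (Hu (mkposreal eps Heps)) as [K HK]; simpl in HK.
  exists K; intros k Hk; specialize (HK k Hk); rewrite Rminus_0_r in HK; exact HK.
Qed.

Lemma cf_num_abs (q : R) (k : nat) : Rabs q < 1 -> Rabs (cf_num q k) <= 2 * Rabs q ^ k.
Proof.
  intros hq; unfold cf_num; rewrite (Nat.mul_comm 2), pow_mult.
  rewrite RPow_abs.
  assert (H : Rabs (q ^ k) <= 1).
  { rewrite <- RPow_abs; apply pow_in_unit_interval; split; [apply Rabs_pos|lra]. }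
  revert H; generalize (q ^ k); intros y H.
  apply Rabs_le_between in H; split_Rabs; nra.
Qed.

Lemma descending_induction (P : nat -> Prop) (K : nat) :
  (forall k, (K <= k)%nat -> P k) -> (forall k, P (S k) -> P k) -> forall k, P k.
Proof.
  intros HK HS k.
  destruct (Nat.le_gt_cases K k) as [H|H]; [auto|].
  assert (Hd : forall d, (d <= K)%nat -> P (K - d)%nat).
  { induction d as [|d IH]; intros Hd; [apply HK; lia|].
    apply HS; replace (S (K - S d)) with (K - d)%nat by lia; apply IH; lia. }
  replace k with (K - (K - k))%nat by lia; apply Hd; lia.
Qed.

(** Here [t k] plays the tail that starts at index k + 1. On [1/2, oo) the map x -> 1 + a/x has
    Lipschitz constant at most 4|a|. As |a_k| <= 2|q|^k, the threshold 1/16 makes |a_k| <= 1/8 from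
    some index on, and each level of the fraction then halves the distance to [t]. The finitely many
    earlier indices follow by continuity of division. *)
Lemma cf_tail_lim (q : R) (t : nat -> R) :
  Rabs q < 1 ->
  (forall k, t k = 1 + cf_num q (S k) / t (S k)) ->
  (forall k, 1/2 <= t k) ->
  forall k, is_lim_seq (fun n => cf_tail q n (S k)) (t k).
Proof.
  intros hq Ht Hge.
  destruct (is_lim_seq_small _ (1/16) (is_lim_seq_pow_index q hq) ltac:(lra)) as [K HK].
  assert (Hsmall : forall k, (K <= k)%nat -> Rabs (cf_num q (S k)) <= 1/8).
  { intros k Hk; apply Rle_trans with (1 := cf_num_abs q (S k) hq).
    specialize (HK (S k) ltac:(lia)); rewrite Rabs_pos_eq in HK; [lra|].
    apply pow_le, Rabs_pos. }
  assert (Hdist : forall n k, (K <= k)%nat ->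
            Rabs (cf_tail q n (S k) - t k) <= (1/2) ^ n).
  { induction n as [|n IH]; intros k Hk.
    - simpl; rewrite (Ht k).
      assert (Hx := Hge (S k)); assert (Ha := Hsmall k Hk).
      replace (1 - (1 + cf_num q (S k) / t (S k)))
        with (- cf_num q (S k) * / t (S k)) by (field; lra).
      rewrite Rabs_mult, Rabs_Ropp, (Rabs_pos_eq (/ _)).
      2: { apply Rlt_le, Rinv_0_lt_compat; lra. }
      assert (Hi : / t (S k) <= 2).
      { replace 2 with (/ (1/2)) by field; apply Rinv_le_contravar; lra. }
      assert (0 < / t (S k)) by (apply Rinv_0_lt_compat; lra).
      assert (Hp := Rabs_pos (cf_num q (S k))).
      nra.
    - simpl; rewrite (Ht k).
      assert (Hx := Hge (S k)); assert (Hy := cf_tail_ge q n (S (S k))).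
      assert (Ha := Hsmall k Hk).
      specialize (IH (S k) ltac:(lia)).
      set (x := t (S k)) in *; set (y := cf_tail q n (S (S k))) in *.
      set (a := cf_num q (S k)) in *.
      replace (1 + a / y - (1 + a / x)) with (- a * (y - x) * / (x * y))
        by (field; split; lra).
      rewrite !Rabs_mult, Rabs_Ropp, (Rabs_pos_eq (/ _)).
      2: { apply Rlt_le, Rinv_0_lt_compat; nra. }
      assert (Hi : / (x * y) <= 4).
      { replace 4 with (/ (1/4)) by field; apply Rinv_le_contravar; nra. }
      assert (0 < / (x * y)) by (apply Rinv_0_lt_compat; nra).
      assert (Hp := Rabs_pos a); assert (Hp' := Rabs_pos (y - x)).
      assert (Rabs a * Rabs (y - x) <= 1/8 * (1/2) ^ n) by nra.
      assert (0 <= Rabs a * Rabs (y - x)) by nra.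
      nra. }
  apply descending_induction with K.
  - intros k Hk.
    apply is_lim_seq_ext with (fun n => (cf_tail q n (S k) - t k) + t k);
      [intros; ring|].
    replace (Finite (t k)) with (Finite (0 + t k)) by (f_equal; ring).
    apply is_lim_seq_plus'; [|apply is_lim_seq_const].
    apply is_lim_seq_abs_0.
    apply is_lim_seq_le_le with (fun _ => 0) (fun n => (1/2) ^ n).
    + intros n; split; [apply Rabs_pos|apply Hdist; exact Hk].
    + apply is_lim_seq_const.
    + apply is_lim_seq_geom; rewrite Rabs_pos_eq; lra.
  - intros k IH.
    apply is_lim_seq_incr_1; simpl; rewrite (Ht k).
    apply is_lim_seq_plus'; [apply is_lim_seq_const|].
    apply is_lim_seq_div'; [apply is_lim_seq_const|exact IH|].
    specialize (Hge (S k)); lra.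
Qed.

Lemma cf_value_of_tails (q : R) (t : nat -> R) :
  Rabs q < 1 ->
  (forall k, t k = 1 + cf_num q (S k) / t (S k)) ->
  (forall k, 1/2 <= t k) ->
  cf_value q = / t 0%nat.
Proof.
  intros hq Ht Hge; unfold cf_value, cf_conv.
  rewrite (is_lim_seq_unique _ (/ t 0%nat)); [reflexivity|].
  assert (H := cf_tail_lim q t hq Ht Hge 0).
  assert (H0 := Hge 0%nat).
  apply is_lim_seq_inv in H; [exact H|].
  intros E; injection E; lra.
Qed.

(** * A series solution of the recurrence attached to the continued fraction *)

(** In standard notation this is (ab; b)_r / (b; b)_r. *)
Fixpoint qratio (a b : R) (r : nat) : R :=
  match r with
  | O => 1
  | S r' => qratio a b r' * (1 - a * b ^ r) / (1 - b ^ r)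
  end.

Lemma qratio_shift (a b : R) (r : nat) :
  Rabs b < 1 -> 1 - a * b <> 0 ->
  qratio (a * b) b r = qratio a b r * (1 - a * b ^ S r) / (1 - a * b).
Proof.
  intros Hb Ha; induction r as [|r IH].
  - simpl; field; exact Ha.
  - change (qratio (a * b) b (S r))
      with (qratio (a * b) b r * (1 - a * b * b ^ S r) / (1 - b ^ S r)).
    change (qratio a b (S r)) with (qratio a b r * (1 - a * b ^ S r) / (1 - b ^ S r)).
    rewrite IH; simpl; field; split; [exact (one_minus_pow_neq_0 b r Hb)|exact Ha].
Qed.

Lemma qratio_1 (b : R) (r : nat) : Rabs b < 1 -> qratio 1 b r = 1.
Proof.
  intros Hb; induction r as [|r IH]; [reflexivity|].
  change (qratio 1 b r * (1 - 1 * b ^ S r) / (1 - b ^ S r) = 1).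
  rewrite IH; field; exact (one_minus_pow_neq_0 b r Hb).
Qed.

Lemma qratio_bound (a b : R) (r : nat) :
  0 <= a <= 1 -> 0 <= b < 1 -> 0 <= qratio a b r <= (/ (1 - b)) ^ r.
Proof.
  intros Ha Hb; induction r as [|r IH]; [simpl; lra|].
  change (qratio a b (S r)) with (qratio a b r * (1 - a * b ^ S r) / (1 - b ^ S r)).
  assert (Hr := pow_in_unit_interval b r ltac:(lra)).
  assert (Hp : b ^ S r <= b) by (simpl; nra).
  assert (Hp0 : 0 <= b ^ S r) by (apply pow_le; lra).
  unfold Rdiv; rewrite Rmult_assoc.
  assert (H1 : 0 <= (1 - a * b ^ S r) * / (1 - b ^ S r) <= / (1 - b)).
  { assert (0 < / (1 - b ^ S r)) by (apply Rinv_0_lt_compat; lra).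
    assert (/ (1 - b ^ S r) <= / (1 - b)) by (apply Rinv_le_contravar; lra).
    assert (0 <= 1 - a * b ^ S r <= 1) by nra.
    split; nra. }
  assert (0 < / (1 - b)) by (apply Rinv_0_lt_compat; lra).
  change ((/ (1 - b)) ^ S r) with (/ (1 - b) * (/ (1 - b)) ^ r).
  split; [nra|].
  rewrite (Rmult_comm (/ (1 - b))).
  apply Rmult_le_compat; lra.
Qed.

(* With [a = X ^ 2], the weight is the very-well-poised factor
   [(1 - X b ^ r) (X ^ 2; b)_r / ((1 - X) (b; b)_r]), written so that [X = 1] is allowed. *)
Definition vwp_weight (b X : R) (r : nat) : R :=
  qratio (X ^ 2) b r + match r with O => 0 | S r' => X * qratio (X ^ 2) b r' end.

Definition cf_term (q X : R) (r : nat) : R :=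
  (-1) ^ r * q ^ (3 * (r * r)) * X ^ (2 * r) * vwp_weight (q ^ 2) X r.

Definition cf_series (q X : R) : R := Series (cf_term q X).

(* The remainder was found by interpolation; it turns the three-term recurrence of the
   series into a telescoping sum. *)
Lemma cf_term_telescope (q X : R) (n : nat) :
  Rabs q < 1 -> Rabs X <= 1 ->
  sum_f_R0 (cf_term q X) n
  - (1 - X * q) * sum_f_R0 (cf_term q (X * q)) n
  - X * q * (1 - X ^ 2 * q ^ 2) * (1 - X * q ^ 2) * sum_f_R0 (cf_term q (X * q ^ 2)) n
  = (-1) ^ n * q ^ (3 * (S n * S n)) * X ^ (2 * S n) * qratio (X ^ 2) (q ^ 2) n
    * (1 + X - X ^ 2 * (q ^ 2) ^ S n).
Proof.
  intros hq hX.
  assert (Hq2 := sqr_lt_1 q hq).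
  assert (HX2 := sqr_le_1 X hX).
  assert (Hb : Rabs (q ^ 2) < 1) by (rewrite Rabs_pos_eq; lra).
  assert (Hs1 : 1 - X ^ 2 * q ^ 2 <> 0) by nra.
  assert (Hs2 : 1 - X ^ 2 * q ^ 2 * q ^ 2 <> 0).
  { assert (0 <= X ^ 2 * q ^ 2 < 1) by nra; nra. }
  (* Replacing X by X q multiplies X^2 by the base q^2, which is one shift of [qratio]; X q^2 costs
     two. All three sums are then expressed through the same quotients, and the induction step
     becomes a field identity. *)
  assert (HXq : forall r, qratio ((X * q) ^ 2) (q ^ 2) r
            = qratio (X ^ 2) (q ^ 2) r * (1 - X ^ 2 * (q ^ 2) ^ S r) / (1 - X ^ 2 * q ^ 2)).
  { intros r; rewrite Rpow_mult_distr; apply qratio_shift; assumption. }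
  assert (HXq2 : forall r, qratio ((X * q ^ 2) ^ 2) (q ^ 2) r
            = qratio (X ^ 2) (q ^ 2) r
              * (1 - X ^ 2 * (q ^ 2) ^ S r) * (1 - X ^ 2 * q ^ 2 * (q ^ 2) ^ S r)
              / ((1 - X ^ 2 * q ^ 2) * (1 - X ^ 2 * q ^ 2 * q ^ 2))).
  { intros r.
    replace ((X * q ^ 2) ^ 2) with (X ^ 2 * q ^ 2 * q ^ 2) by ring.
    rewrite !qratio_shift by assumption.
    generalize (qratio (X ^ 2) (q ^ 2) r); revert Hs1 Hs2; clear.
    generalize (X ^ 2) (q ^ 2); intros a b H1 H2 g; field; split; assumption. }
  induction n as [|n IH].
  - unfold cf_term, vwp_weight; simpl; ring.
  - rewrite !tech5.
    match goal with |- ?a + ?u - ?c * (?b + ?v) - ?d * (?e + ?w) = ?rhs =>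
      replace (a + u - c * (b + v) - d * (e + w))
        with ((a - c * b - d * e) + (u - c * v - d * w)) by ring end.
    rewrite IH; clear IH.
    unfold cf_term, vwp_weight.
    rewrite !HXq, !HXq2.
    change (qratio (X ^ 2) (q ^ 2) (S n)) with
      (qratio (X ^ 2) (q ^ 2) n * (1 - X ^ 2 * (q ^ 2) ^ S n) / (1 - (q ^ 2) ^ S n)).
    generalize (qratio (X ^ 2) (q ^ 2) n); intros g.
    assert (Hn := one_minus_pow_neq_0 (q ^ 2) n Hb).
    replace (3 * (S (S n) * S (S n)))%nat with (3 * (S n * S n) + (6 * n + 9))%nat by lia.
    rewrite !Rpow_mult_distr.
    rewrite !pow_add.
    replace (q ^ (6 * n)) with ((q ^ 2) ^ n * (q ^ 2) ^ n * (q ^ 2) ^ n)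
      by (rewrite <- !pow_add, <- pow_mult; f_equal; lia).
    replace ((q ^ 2) ^ (2 * S n)) with ((q ^ 2) ^ n * (q ^ 2) ^ n * q ^ 4)
      by (rewrite <- !pow_mult, <- !pow_add; f_equal; lia).
    replace (q ^ (2 * S n)) with ((q ^ 2) ^ n * q ^ 2)
      by (rewrite <- !pow_mult, <- !pow_add; f_equal; lia).
    replace (X ^ (2 * S (S n))) with (X ^ (2 * S n) * X ^ 2)
      by (rewrite <- !pow_add; f_equal; lia).
    generalize (X ^ (2 * S n)) (q ^ (3 * (S n * S n))); intros Y Z.
    revert Hn.
    change ((q ^ 2) ^ S (S n)) with (q ^ 2 * (q ^ 2 * (q ^ 2) ^ n)).
    change ((q ^ 2) ^ S n) with (q ^ 2 * (q ^ 2) ^ n).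
    change ((-1) ^ S n) with (-1 * (-1) ^ n).
    generalize ((-1) ^ n) ((q ^ 2) ^ n); intros e Q Hn.
    field; repeat split.
    + exact Hn.
    + intros E; apply Hs2; rewrite <- E; ring.
    + intros E; apply Hs1; rewrite <- E; ring.
Qed.

(** * Uniform bounds and the recurrence of the series *)

Definition majorant (q : R) (r : nat) : R :=
  (Rabs q ^ 3) ^ (r * r) * (/ (1 - q ^ 2)) ^ r.

Lemma majorant_ge_0 (q : R) (r : nat) : Rabs q < 1 -> 0 <= majorant q r.
Proof.
  intros hq; assert (H := sqr_lt_1 q hq).
  apply Rmult_le_pos; apply pow_le; [apply pow_le, Rabs_pos|].
  apply Rlt_le, Rinv_0_lt_compat; lra.
Qed.

Lemma ex_series_majorant (q : R) : Rabs q < 1 -> ex_series (majorant q).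
Proof.
  intros hq; assert (H := sqr_lt_1 q hq).
  apply ex_series_pow_sqr.
  - split; [apply pow_le, Rabs_pos|].
    apply pow_lt_1_compat; [|lia]; split; [apply Rabs_pos|exact hq].
  - apply Rlt_le, Rinv_0_lt_compat; lra.
Qed.

Lemma Rinv_one_minus_ge_1 (b : R) : 0 <= b < 1 -> 1 <= / (1 - b).
Proof. intros H; rewrite <- Rinv_1; apply Rinv_le_contravar; lra. Qed.

Lemma vwp_weight_bound (b X : R) (r : nat) :
  0 <= b < 1 -> Rabs X <= 1 -> Rabs (vwp_weight b X r) <= 2 * (/ (1 - b)) ^ r.
Proof.
  intros Hb hX; unfold vwp_weight.
  assert (HX2 := sqr_le_1 X hX).
  assert (HK := Rinv_one_minus_ge_1 b Hb).
  assert (Hg := qratio_bound (X ^ 2) b r HX2 Hb).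
  apply Rle_trans with (1 := Rabs_triang _ _).
  rewrite (Rabs_pos_eq (qratio _ _ _)) by apply Hg.
  destruct r as [|r]; [simpl; rewrite Rabs_R0; lra|].
  assert (Hg' := qratio_bound (X ^ 2) b r HX2 Hb).
  rewrite Rabs_mult, (Rabs_pos_eq (qratio _ _ r)) by apply Hg'.
  change ((/ (1 - b)) ^ S r) with (/ (1 - b) * (/ (1 - b)) ^ r) in *.
  assert (0 <= Rabs X) by apply Rabs_pos.
  assert (0 <= (/ (1 - b)) ^ r) by (apply pow_le; lra).
  assert (Rabs X * qratio (X ^ 2) b r <= (/ (1 - b)) ^ r) by nra.
  nra.
Qed.

Lemma cf_term_bound (q X : R) (r : nat) :
  Rabs q < 1 -> Rabs X <= 1 -> Rabs (cf_term q X r) <= 2 * ((X ^ 2) ^ r * majorant q r).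
Proof.
  intros hq hX; unfold cf_term, majorant.
  rewrite !Rabs_mult, pow_1_abs, Rmult_1_l, <- !RPow_abs, pow_mult.
  rewrite (pow_mult _ 2), pow2_abs.
  assert (H := vwp_weight_bound (q ^ 2) X r (sqr_lt_1 q hq) hX).
  assert (H1 : 0 <= (Rabs q ^ 3) ^ (r * r)) by (apply pow_le, pow_le, Rabs_pos).
  assert (H2 : 0 <= (X ^ 2) ^ r) by (apply pow_le, pow2_ge_0).
  apply Rle_trans with ((Rabs q ^ 3) ^ (r * r) * (X ^ 2) ^ r * (2 * (/ (1 - q ^ 2)) ^ r)).
  - apply Rmult_le_compat_l; [apply Rmult_le_pos; assumption|exact H].
  - right; ring.
Qed.

Lemma ex_series_cf_term (q X : R) :
  Rabs q < 1 -> Rabs X <= 1 -> ex_series (cf_term q X).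
Proof.
  intros hq hX.
  apply (@ex_series_le R_AbsRing R_CompleteNormedModule _ (fun r => 2 * majorant q r)).
  2: { apply ex_series_Rmult, ex_series_majorant, hq. }
  intros r; apply Rle_trans with (1 := cf_term_bound q X r hq hX).
  assert (H := pow_in_unit_interval (X ^ 2) r (sqr_le_1 X hX)).
  assert (H1 := majorant_ge_0 q r hq).
  nra.
Qed.

(** The term r = 0 is 1 and every later one carries a factor X^2; the remaining factor is bounded by
    a summable majorant independent of X. This gives the normalization S(0) = 1 together with a
    rate. *)
Lemma cf_series_near_1 (q X : R) :
  Rabs q < 1 -> Rabs X <= 1 ->
  Rabs (cf_series q X - 1) <= X ^ 2 * Series (fun r => 2 * majorant q (S r)).
Proof.
  intros hq hX; unfold cf_series.
  assert (Hex := ex_series_cf_term q X hq hX).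
  assert (HM : ex_series (fun r => X ^ 2 * (2 * majorant q (S r)))).
  { do 2 apply ex_series_Rmult.
    apply (ex_series_incr_1 (majorant q)), ex_series_majorant, hq. }
  assert (Hle : forall r, 0 <= Rabs (cf_term q X (S r)) <= X ^ 2 * (2 * majorant q (S r))).
  { intros r; split; [apply Rabs_pos|].
    apply Rle_trans with (1 := cf_term_bound q X (S r) hq hX).
    assert (H := pow_in_unit_interval (X ^ 2) r (sqr_le_1 X hX)).
    assert (H1 := majorant_ge_0 q (S r) hq).
    assert (H2 := sqr_le_1 X hX).
    change ((X ^ 2) ^ S r) with (X ^ 2 * (X ^ 2) ^ r).
    assert (0 <= X ^ 2 * majorant q (S r)) by nra.
    nra. }
  rewrite (Series_incr_1 _ Hex).
  replace (cf_term q X 0) with 1 by (unfold cf_term, vwp_weight; simpl; ring).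
  replace (1 + _ - 1) with (Series (fun k => cf_term q X (S k))) by ring.
  rewrite <- Series_scal_l.
  apply Rle_trans with (Series (fun r => Rabs (cf_term q X (S r)))).
  - apply Series_Rabs.
    apply (@ex_series_le R_AbsRing R_CompleteNormedModule _ _) with (2 := HM).
    intros r; unfold norm; simpl; unfold abs; simpl.
    rewrite Rabs_Rabsolu; apply Hle.
  - apply Series_le; assumption.
Qed.

(** This is the limit of [cf_term_telescope], whose remainder is at most three times a majorant
    term. Division by (Xq; q)_oo would turn it into the recurrence of F, since 1 - X^2 q^2 = (1 -
    Xq)(1 + Xq). *)
Lemma cf_series_rec (q X : R) :
  Rabs q < 1 -> Rabs X <= 1 ->
  cf_series q X = (1 - X * q) * cf_series q (X * q)
    + X * q * (1 - X ^ 2 * q ^ 2) * (1 - X * q ^ 2) * cf_series q (X * q ^ 2).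
Proof.
  intros hq hX.
  assert (Hq1 : Rabs (X * q) <= 1).
  { rewrite Rabs_mult; assert (0 <= Rabs X) by apply Rabs_pos.
    assert (0 <= Rabs q) by apply Rabs_pos; nra. }
  assert (Hq2 : Rabs (X * q ^ 2) <= 1).
  { replace (X * q ^ 2) with (X * q * q) by ring.
    rewrite Rabs_mult; assert (0 <= Rabs (X * q)) by apply Rabs_pos.
    assert (0 <= Rabs q) by apply Rabs_pos; nra. }
  assert (L0 := is_lim_seq_partial_sums _ (ex_series_cf_term q X hq hX)).
  assert (L1 := is_lim_seq_partial_sums _ (ex_series_cf_term q (X * q) hq Hq1)).
  assert (L2 := is_lim_seq_partial_sums _ (ex_series_cf_term q (X * q ^ 2) hq Hq2)).
  fold (cf_series q X) in L0; fold (cf_series q (X * q)) in L1.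
  fold (cf_series q (X * q ^ 2)) in L2.
  assert (L := is_lim_seq_minus' _ _ _ _ (is_lim_seq_minus' _ _ _ _ L0
    (is_lim_seq_mult' _ _ _ _ (is_lim_seq_const (1 - X * q)) L1))
    (is_lim_seq_mult' _ _ _ _
      (is_lim_seq_const (X * q * (1 - X ^ 2 * q ^ 2) * (1 - X * q ^ 2))) L2)).
  assert (Z : is_lim_seq (fun n => sum_f_R0 (cf_term q X) n
     - (1 - X * q) * sum_f_R0 (cf_term q (X * q)) n
     - X * q * (1 - X ^ 2 * q ^ 2) * (1 - X * q ^ 2)
       * sum_f_R0 (cf_term q (X * q ^ 2)) n) 0).
  { apply is_lim_seq_abs_0.
    apply is_lim_seq_le_le with (fun _ => 0) (fun n => 3 * majorant q (S n)).
    - intros n; split; [apply Rabs_pos|].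
      rewrite (cf_term_telescope q X n hq hX).
      assert (HX2 := sqr_le_1 X hX); assert (Hb := sqr_lt_1 q hq).
      rewrite !Rabs_mult, pow_1_abs, Rmult_1_l, <- !RPow_abs, (pow_mult _ 3), (pow_mult _ 2).
      rewrite pow2_abs.
      assert (Hg := qratio_bound (X ^ 2) (q ^ 2) n HX2 Hb).
      rewrite (Rabs_pos_eq (qratio _ _ _)) by apply Hg.
      unfold majorant.
      assert (HK := Rinv_one_minus_ge_1 _ Hb).
      change ((/ (1 - q ^ 2)) ^ S n) with (/ (1 - q ^ 2) * (/ (1 - q ^ 2)) ^ n).
      assert (H1 : 0 <= (Rabs q ^ 3) ^ (S n * S n)) by (apply pow_le, pow_le, Rabs_pos).
      assert (H2 := pow_in_unit_interval (X ^ 2) (S n) HX2).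
      assert (H3 : Rabs (1 + X - X ^ 2 * (q ^ 2) ^ S n) <= 3).
      { assert (H3 := pow_in_unit_interval (q ^ 2) (S n) ltac:(lra)).
        assert (0 <= X ^ 2 * (q ^ 2) ^ S n <= 1) by nra.
        apply Rabs_le_between in hX; apply Rabs_le; lra. }
      assert (Hp := Rabs_pos (1 + X - X ^ 2 * (q ^ 2) ^ S n)).
      revert H1 H2 H3 Hg HK Hp.
      generalize (/ (1 - q ^ 2)) ((Rabs q ^ 3) ^ (S n * S n)) ((X ^ 2) ^ S n)
        (Rabs (1 + X - X ^ 2 * (q ^ 2) ^ S n)) (qratio (X ^ 2) (q ^ 2) n)
        ((/ (1 - q ^ 2)) ^ n).
      clear; intros K A B D g Kn H1 H2 H3 Hg HK Hp.
      assert (Hk : g <= K * Kn).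
      { assert (0 <= (K - 1) * Kn) by (apply Rmult_le_pos; lra); lra. }
      assert (H4 : 0 <= A * B <= A) by nra.
      assert (H5 : A * B * g <= A * (K * Kn)) by (apply Rmult_le_compat; lra).
      assert (H6 : 0 <= A * B * g) by (apply Rmult_le_pos; lra).
      nra.
    - apply is_lim_seq_const.
    - replace (Finite 0) with (Finite (3 * 0)) by (f_equal; ring).
      apply is_lim_seq_mult'; [apply is_lim_seq_const|].
      apply -> (is_lim_seq_incr_1 (majorant q)).
      apply ex_series_lim_0, ex_series_majorant, hq. }
  apply is_lim_seq_unique in L; apply is_lim_seq_unique in Z.
  rewrite Z in L; apply Rbar_finite_eq in L; lra.
Qed.

Lemma cf_series_pow_rec (q : R) (k : nat) :
  Rabs q < 1 ->
  cf_series q (q ^ k) = (1 - q ^ S k) * cf_series q (q ^ S k)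
    + cf_num q (S k) * (1 - q ^ S k) * (1 - q ^ S (S k)) * cf_series q (q ^ S (S k)).
Proof.
  intros hq.
  assert (hX : Rabs (q ^ k) <= 1).
  { rewrite <- RPow_abs; apply pow_in_unit_interval; split; [apply Rabs_pos|lra]. }
  rewrite (cf_series_rec q (q ^ k) hq hX).
  replace (q ^ k * q) with (q ^ S k) by (simpl; ring).
  replace (q ^ k * q ^ 2) with (q ^ S (S k)) by (simpl; ring).
  unfold cf_num; rewrite (Nat.mul_comm 2), pow_mult; simpl; ring.
Qed.

Lemma is_lim_seq_cf_series (q : R) :
  Rabs q < 1 -> is_lim_seq (fun k => cf_series q (q ^ k) - 1) 0.
Proof.
  intros hq; apply is_lim_seq_abs_0.
  set (B := Series (fun r => 2 * majorant q (S r))).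
  apply is_lim_seq_le_le with (fun _ => 0) (fun k => (q ^ 2) ^ k * B).
  - intros k; split; [apply Rabs_pos|].
    rewrite <- pow_mult, Nat.mul_comm, pow_mult.
    apply cf_series_near_1; [exact hq|].
    rewrite <- RPow_abs; apply pow_in_unit_interval; split; [apply Rabs_pos|lra].
  - apply is_lim_seq_const.
  - replace (Finite 0) with (Finite (0 * B)) by (f_equal; ring).
    apply is_lim_seq_mult'; [|apply is_lim_seq_const].
    apply is_lim_seq_geom; assert (H := sqr_lt_1 q hq); rewrite Rabs_pos_eq; lra.
Qed.

(* Since [cf_series q X] tends to 1 as [X -> 0], these tails are eventually at least 1/2;
   [cf_num q k >= - 1/4] propagates this bound downwards. *)
Definition cf_limit_tail (q : R) (k : nat) : R :=
  cf_series q (q ^ k) / ((1 - q ^ S k) * cf_series q (q ^ S k)).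

Lemma cf_limit_tail_props (q : R) (k : nat) :
  Rabs q < 1 ->
  0 < cf_series q (q ^ k) /\ 0 < cf_series q (q ^ S k) /\ 1/2 <= cf_limit_tail q k.
Proof.
  intros hq.
  (* Past both thresholds the two series values lie in (0.9, 1.1) and 1 - q^(k+1) is below 1.1, so
     the quotient exceeds 0.9/1.21 > 1/2. *)
  destruct (is_lim_seq_small _ (1/10) (is_lim_seq_cf_series q hq) ltac:(lra)) as [K1 HK1].
  destruct (is_lim_seq_small _ (1/10) (is_lim_seq_pow_index q hq) ltac:(lra)) as [K2 HK2].
  revert k; apply descending_induction with (K1 + K2)%nat.
  - intros k Hk.
    assert (H1 := HK1 k ltac:(lia)); assert (H2 := HK1 (S k) ltac:(lia)).
    assert (H3 := HK2 (S k) ltac:(lia)).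
    rewrite RPow_abs, Rabs_Rabsolu in H3.
    unfold cf_limit_tail.
    revert H1 H2 H3.
    generalize (q ^ S k) (cf_series q (q ^ k)) (cf_series q (q ^ S k)).
    intros z x y H1 H2 H3.
    apply Rabs_def2 in H1; apply Rabs_def2 in H2; apply Rabs_def2 in H3.
    split; [lra|split; [lra|]].
    assert (0 < (1 - z) * y) by nra.
    apply (Rmult_le_reg_r ((1 - z) * y)); [assumption|].
    replace (x / ((1 - z) * y) * ((1 - z) * y)) with x by (field; split; lra).
    nra.
  - intros k [H1 [H2 H3]].
    assert (Hp1 := one_minus_pow_gt_0 q k hq).
    assert (Hp2 := one_minus_pow_gt_0 q (S k) hq).
    (* The recurrence, with its right side factored so that the next tail appears. The last factor
       is at least 1/2, which carries the positivity of the series down to index k along with the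
       bound on the tail. *)
    assert (Heq : cf_series q (q ^ k)
      = (1 - q ^ S k) * cf_series q (q ^ S k)
        * (1 + cf_num q (S k) / cf_limit_tail q (S k))).
    { rewrite (cf_series_pow_rec q k hq); unfold cf_limit_tail.
      field; repeat split; lra. }
    assert (Hd := one_plus_div_ge _ _ (cf_num_lower q (S k)) H3).
    assert (Hpos : 0 < (1 - q ^ S k) * cf_series q (q ^ S k)) by nra.
    split; [rewrite Heq; apply Rmult_lt_0_compat; lra|split; [exact H1|]].
    unfold cf_limit_tail at 1; rewrite Heq.
    apply Rle_trans with (1 := Hd); right; field; repeat split; lra.
Qed.

Lemma cf_value_series (q : R) :
  Rabs q < 1 -> cf_value q = (1 - q) * cf_series q q / cf_series q 1.
Proof.
  intros hq.
  rewrite (cf_value_of_tails q (cf_limit_tail q) hq).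
  - destruct (cf_limit_tail_props q 0 hq) as [H1 [H2 _]].
    assert (H := one_minus_pow_gt_0 q 0 hq).
    unfold cf_limit_tail; simpl in *; rewrite Rmult_1_r in *.
    field; repeat split; lra.
  - intros k.
    destruct (cf_limit_tail_props q (S k) hq) as [H1 [H2 _]].
    assert (Hp1 := one_minus_pow_gt_0 q k hq).
    assert (Hp2 := one_minus_pow_gt_0 q (S k) hq).
    unfold cf_limit_tail at 1; rewrite (cf_series_pow_rec q k hq).
    unfold cf_limit_tail; field; repeat split; lra.
  - intros k; apply (cf_limit_tail_props q k hq).
Qed.

(* [phi y] is Ramanujan's phi(-y) = sum over Z of (-1)^r y^(r^2), and [f15 q] below is
   f(-q,-q^5) = sum over Z of (-1)^r q^(3r^2+2r), with [r] and [- r - 1] paired. *)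
Definition phi_term (y : R) (r : nat) : R :=
  match r with O => 1 | S _ => 2 * (-1) ^ r * y ^ (r * r) end.

Definition phi (y : R) : R := Series (phi_term y).

Definition f15_term (q : R) (r : nat) : R :=
  (-1) ^ r * (1 - q ^ (2 * r + 1)) * q ^ (3 * (r * r) + 2 * r).

Definition f15 (q : R) : R := Series (f15_term q).

(** * Collapse to theta series at X = 1 and X = q *)

Lemma cf_term_at_1 (q : R) (r : nat) : Rabs q < 1 -> cf_term q 1 r = phi_term (q ^ 3) r.
Proof.
  intros hq.
  assert (Hb : Rabs (q ^ 2) < 1) by (assert (H := sqr_lt_1 q hq); rewrite Rabs_pos_eq; lra).
  unfold cf_term, vwp_weight, phi_term.
  replace (1 ^ 2) with 1 by ring; rewrite pow1.
  destruct r as [|r]; [simpl; ring|].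
  rewrite !qratio_1 by exact Hb; rewrite <- pow_mult; ring.
Qed.

(** For X^2 equal to the base the product [qratio] telescopes to (1 - q^(2r+2))/(1 - q^2), and the
    weight becomes (1 - q^(2r+1))/(1 - q). Its denominator is cancelled by the factor 1 - q of
    [cf_value_series]. *)
Lemma cf_term_at_q (q : R) (r : nat) : Rabs q < 1 -> (1 - q) * cf_term q q r = f15_term q r.
Proof.
  intros hq.
  assert (Hq2 := sqr_lt_1 q hq).
  assert (Hb : Rabs (q ^ 2) < 1) by (rewrite Rabs_pos_eq; lra).
  assert (Hg : forall r, qratio (q ^ 2) (q ^ 2) r = (1 - (q ^ 2) ^ S r) / (1 - q ^ 2)).
  { intros s; rewrite <- (Rmult_1_l (q ^ 2)) at 1.
    rewrite qratio_shift by (assumption || lra).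
    rewrite (qratio_1 _ s Hb); field; lra. }
  unfold cf_term, vwp_weight, f15_term.
  destruct r as [|r]; [simpl; ring|].
  rewrite !Hg, !pow_add.
  replace (q ^ (2 * S r)) with ((q ^ 2) ^ S r) by (rewrite <- pow_mult; reflexivity).
  change ((q ^ 2) ^ S (S r)) with (q ^ 2 * (q ^ 2) ^ S r).
  field; lra.
Qed.

(** The nonvanishing of the theta value comes from the positivity of the series at X = 1 in
    [cf_limit_tail_props], not from a product formula. *)
Lemma cf_value_theta (q : R) :
  Rabs q < 1 -> phi (q ^ 3) <> 0 /\ cf_value q = f15 q / phi (q ^ 3).
Proof.
  intros hq.
  assert (E1 : cf_series q 1 = phi (q ^ 3)).
  { apply Series_ext; intros r; apply cf_term_at_1, hq. }
  assert (E2 : (1 - q) * cf_series q q = f15 q).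
  { unfold cf_series; rewrite <- Series_scal_l.
    apply Series_ext; intros r; apply cf_term_at_q, hq. }
  destruct (cf_limit_tail_props q 0 hq) as [H _]; simpl in H.
  rewrite <- E1, <- E2; split; [lra|].
  apply cf_value_series, hq.
Qed.

(** * Gauss's product for the theta series, over the complex numbers *)

Fixpoint Cqratio (a b : C) (r : nat) : C :=
  match r with
  | O => 1
  | S r' => Cqratio a b r' * (1 - a * b ^ r) / (1 - b ^ r)
  end%C.

Lemma Cone_minus_neq_0 (a : C) : Cmod a < 1 -> (1 - a)%C <> 0.
Proof.
  intros Ha E.
  replace a with (1 - (1 - a))%C in Ha by ring.
  rewrite E in Ha; replace (1 - 0)%C with (RtoC 1) in Ha by ring.
  rewrite Cmod_1 in Ha; lra.
Qed.

Lemma Cmod_pow_S_lt_1 (b : C) (n : nat) : Cmod b < 1 -> Cmod (b ^ S n) < 1.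
Proof.
  intros Hb; rewrite Cmod_pow; apply pow_lt_1_compat; [|lia].
  split; [apply Cmod_ge_0|exact Hb].
Qed.

Lemma Cqratio_shift (a b : C) (r : nat) :
  Cmod b < 1 -> (1 - a * b)%C <> 0 ->
  Cqratio (a * b) b r = (Cqratio a b r * (1 - a * b ^ S r) / (1 - a * b))%C.
Proof.
  intros Hb Ha; induction r as [|r IH].
  - simpl; field; exact Ha.
  - change (Cqratio (a * b) b (S r))
      with (Cqratio (a * b) b r * (1 - a * b * b ^ S r) / (1 - b ^ S r))%C.
    change (Cqratio a b (S r)) with (Cqratio a b r * (1 - a * b ^ S r) / (1 - b ^ S r))%C.
    assert (H := Cone_minus_neq_0 _ (Cmod_pow_S_lt_1 b r Hb)).
    rewrite IH; simpl; field; split; [exact H|exact Ha].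
Qed.

Lemma Cqratio_1 (b : C) (r : nat) : Cmod b < 1 -> Cqratio 1 b r = 1.
Proof.
  intros Hb; induction r as [|r IH]; [reflexivity|].
  change ((Cqratio 1 b r * (1 - 1 * b ^ S r) / (1 - b ^ S r))%C = 1).
  rewrite IH; field; exact (Cone_minus_neq_0 _ (Cmod_pow_S_lt_1 b r Hb)).
Qed.

Lemma Cmod_minus_le (x y : C) : Cmod (x - y) <= Cmod x + Cmod y.
Proof. unfold Cminus; rewrite <- (Cmod_opp y); apply Cmod_triangle. Qed.

Lemma Cmod_minus_ge (x y : C) : Cmod x - Cmod y <= Cmod (x - y).
Proof.
  assert (H := Cmod_triangle (x - y) y).
  replace (x - y + y)%C with x in H by ring; lra.
Qed.

(** Each numerator has modulus at most 2, where the real case had 1, and each denominator at least 1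
    - |b|. *)
Lemma Cqratio_bound (a b : C) (r : nat) :
  Cmod a <= 1 -> Cmod b < 1 -> Cmod (Cqratio a b r) <= (2 / (1 - Cmod b)) ^ r.
Proof.
  intros Ha Hb; induction r as [|r IH]; [simpl; rewrite Cmod_1; lra|].
  change (Cqratio a b (S r)) with (Cqratio a b r * (1 - a * b ^ S r) / (1 - b ^ S r))%C.
  unfold Cdiv; rewrite !Cmod_mult.
  rewrite Cmod_inv by exact (Cone_minus_neq_0 _ (Cmod_pow_S_lt_1 b r Hb)).
  assert (Hb0 := Cmod_ge_0 b); assert (Ha0 := Cmod_ge_0 a).
  assert (Hr := pow_in_unit_interval (Cmod b) r ltac:(lra)).
  assert (Hp : Cmod (b ^ S r) <= Cmod b) by (rewrite Cmod_pow; simpl; nra).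
  assert (Hp0 := Cmod_ge_0 (b ^ S r)).
  assert (H1 : Cmod (1 - a * b ^ S r) <= 2).
  { apply Rle_trans with (1 := Cmod_minus_le _ _).
    rewrite Cmod_1, Cmod_mult; nra. }
  assert (H2 : 1 - Cmod b <= Cmod (1 - b ^ S r)).
  { assert (H := Cmod_minus_ge 1 (b ^ S r)); rewrite Cmod_1 in H; lra. }
  assert (H3 : / Cmod (1 - b ^ S r) <= / (1 - Cmod b)) by (apply Rinv_le_contravar; lra).
  assert (H4 : 0 < / Cmod (1 - b ^ S r)) by (apply Rinv_0_lt_compat; lra).
  change ((2 / (1 - Cmod b)) ^ S r) with (2 / (1 - Cmod b) * (2 / (1 - Cmod b)) ^ r).
  rewrite (Rmult_comm (2 / _)), Rmult_assoc.
  unfold Rdiv; apply Rmult_le_compat; [apply Cmod_ge_0| |exact IH|].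
  - apply Rmult_le_pos; [apply Cmod_ge_0|lra].
  - apply Rmult_le_compat; [apply Cmod_ge_0|lra|exact H1|exact H3].
Qed.

(* The terms of the limiting very-well-poised 6phi5 sum with value
   (X^2 z; z)_oo / (- X z; z)_oo, whose case [X = 1] is Gauss's product. *)
Definition gauss_term (z X : C) (r : nat) : C :=
  ((-1) ^ r * z ^ (r * r) * X ^ r
   * (Cqratio (X ^ 2) z r + match r with O => 0 | S r' => X * Cqratio (X ^ 2) z r' end))%C.

Fixpoint Csum (f : nat -> C) (n : nat) : C :=
  match n with O => f O | S n' => (Csum f n' + f n)%C end.

Lemma Csum_S (f : nat -> C) (n : nat) : Csum f (S n) = (Csum f n + f (S n))%C.
Proof. reflexivity. Qed.

Lemma Cmod_sqr_le_1 (X : C) : Cmod X <= 1 -> Cmod (X ^ 2) <= 1.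
Proof.
  intros HX; rewrite Cmod_pow; apply pow_in_unit_interval.
  split; [apply Cmod_ge_0|exact HX].
Qed.

(** A truncated form of G(X) = (1 - X^2 z)(1 - Xz) G(Xz), the functional equation of (X^2 z; z)_oo /
    (-Xz; z)_oo. Only two terms occur, and X -> Xz shifts [Cqratio] twice because its parameter is
    X^2. *)
Lemma gauss_telescope (z X : C) (n : nat) :
  Cmod z < 1 -> Cmod X <= 1 ->
  (Csum (gauss_term z X) n
  - (1 - X ^ 2 * z) * (1 - X * z) * Csum (gauss_term z (X * z)) n
  = (-1) ^ n * z ^ (S n * S n) * X ^ S n * Cqratio (X ^ 2) z n
    * (1 + X - X ^ 2 * z ^ S n))%C.
Proof.
  intros Hz HX.
  assert (HX2 := Cmod_sqr_le_1 X HX).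
  assert (Hz0 := Cmod_ge_0 z); assert (HX0 := Cmod_ge_0 (X ^ 2)).
  assert (Hm1 : Cmod (X ^ 2 * z) < 1) by (rewrite Cmod_mult; nra).
  assert (Hm2 : Cmod (X ^ 2 * z * z) < 1).
  { rewrite Cmod_mult; assert (H := Cmod_ge_0 (X ^ 2 * z)); nra. }
  assert (Hs1 := Cone_minus_neq_0 _ Hm1).
  assert (Hs2 := Cone_minus_neq_0 _ Hm2).
  assert (Hq : forall r, Cqratio ((X * z) ^ 2) z r
            = (Cqratio (X ^ 2) z r
              * (1 - X ^ 2 * z ^ S r) * (1 - X ^ 2 * z * z ^ S r)
              / ((1 - X ^ 2 * z) * (1 - X ^ 2 * z * z)))%C).
  { intros r.
    replace ((X * z) ^ 2)%C with (X ^ 2 * z * z)%C by ring.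
    rewrite !Cqratio_shift by assumption.
    generalize (Cqratio (X ^ 2) z r); revert Hs1 Hs2; clear.
    generalize (X ^ 2)%C; intros a H1 H2 g; field; split; assumption. }
  induction n as [|n IH].
  - unfold gauss_term; simpl; ring.
  - rewrite !Csum_S.
    match goal with |- (?a + ?u - ?c * (?b + ?v))%C = ?rhs =>
      replace (a + u - c * (b + v))%C with ((a - c * b) + (u - c * v))%C by ring end.
    rewrite IH; clear IH.
    unfold gauss_term.
    rewrite !Hq.
    change (Cqratio (X ^ 2) z (S n)) with
      (Cqratio (X ^ 2) z n * (1 - X ^ 2 * z ^ S n) / (1 - z ^ S n))%C.
    generalize (Cqratio (X ^ 2) z n); intros g.
    assert (Hn := Cone_minus_neq_0 _ (Cmod_pow_S_lt_1 z n Hz)).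
    replace (S (S n) * S (S n))%nat with (S n * S n + (2 * n + 3))%nat by lia.
    rewrite Cpow_mult_l, !Cpow_add_r.
    replace (z ^ (2 * n))%C with (z ^ n * z ^ n)%C
      by (rewrite <- Cpow_add_r; f_equal; lia).
    rewrite !(Cpow_S _ (S n)), !(Cpow_S _ n).
    rewrite (Cpow_S _ n) in Hn.
    revert Hn.
    generalize (X ^ n)%C (z ^ (S n * S n))%C ((-1) ^ n)%C (z ^ n)%C; intros Y Z e Q Hn.
    field; repeat split.
    + exact Hn.
    + intros E; apply Hs2; rewrite <- E; ring.
    + intros E; apply Hs1; rewrite <- E; ring.
Qed.

Definition gauss_phi_term (z : C) (r : nat) : C :=
  match r with O => 1 | S _ => 2 * (-1) ^ r * z ^ (r * r) end%C.

(** The factors are those of the functional equation at X = 1, z, z^2, ... . By Euler's (z; z^2)_oo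
    = 1/(-z; z)_oo this is Gauss's (z; z)_oo/(-z; z)_oo, in a form free of division. *)
Fixpoint gauss_prod (z : C) (n : nat) : C :=
  match n with
  | O => 1
  | S n' => gauss_prod z n' * ((1 - z ^ (2 * n' + 1)) * (1 - z ^ n))
  end%C.

Lemma gauss_term_at_1 (z : C) (n : nat) :
  Cmod z < 1 -> Csum (gauss_term z 1) n = Csum (gauss_phi_term z) n.
Proof.
  intros Hz.
  assert (H : forall r, gauss_term z 1 r = gauss_phi_term z r).
  { intros r; unfold gauss_term, gauss_phi_term.
    replace (1 ^ 2)%C with (RtoC 1) by ring; rewrite Cpow_1_l.
    destruct r as [|r]; [simpl; ring|].
    rewrite !Cqratio_1 by exact Hz; ring. }
  induction n as [|n IH]; simpl; [apply H|rewrite IH, H; reflexivity].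
Qed.

Lemma Cmod_m1_pow (n : nat) : Cmod ((-1) ^ n) = 1.
Proof.
  rewrite Cmod_pow; replace (Cmod (-1)) with 1; [apply pow1|].
  rewrite Cmod_R, Rabs_left; lra.
Qed.

Definition gauss_majorant (rho : R) (r : nat) : R := rho ^ (r * r) * (2 / (1 - rho)) ^ r.

Lemma gauss_ratio_ge_1 (rho : R) : 0 <= rho < 1 -> 1 <= 2 / (1 - rho).
Proof.
  intros H; apply (Rmult_le_reg_r (1 - rho)); [lra|].
  unfold Rdiv; rewrite Rmult_assoc, Rinv_l; lra.
Qed.

Lemma gauss_majorant_ge_0 (rho : R) (r : nat) : 0 <= rho < 1 -> 0 <= gauss_majorant rho r.
Proof.
  intros H; assert (H1 := gauss_ratio_ge_1 rho H).
  apply Rmult_le_pos; apply pow_le; lra.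
Qed.

Lemma gauss_remainder_bound (z X : C) (n : nat) :
  Cmod z < 1 -> Cmod X <= 1 ->
  Cmod (Csum (gauss_term z X) n
    - (1 - X ^ 2 * z) * (1 - X * z) * Csum (gauss_term z (X * z)) n)
  <= 3 * gauss_majorant (Cmod z) (S n).
Proof.
  intros Hz HX; rewrite (gauss_telescope z X n Hz HX).
  rewrite !Cmod_mult, Cmod_m1_pow, !Cmod_pow, Rmult_1_l.
  assert (HX2 := Cmod_sqr_le_1 X HX).
  assert (Hg := Cqratio_bound (X ^ 2) z n HX2 Hz).
  assert (Hg0 := Cmod_ge_0 (Cqratio (X ^ 2) z n)).
  assert (Hz0 := Cmod_ge_0 z); assert (HX0 := Cmod_ge_0 X).
  assert (HXn := pow_in_unit_interval (Cmod X) (S n) ltac:(lra)).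
  assert (Hzn := pow_in_unit_interval (Cmod z) (S n * S n) ltac:(lra)).
  assert (HK := gauss_ratio_ge_1 (Cmod z) ltac:(lra)).
  assert (HKn : 0 <= (2 / (1 - Cmod z)) ^ n) by (apply pow_le; lra).
  assert (H3 : Cmod (1 + X - X ^ 2 * z ^ S n) <= 3).
  { apply Rle_trans with (1 := Cmod_minus_le _ _).
    assert (H := Cmod_triangle 1 X); rewrite Cmod_1 in H.
    assert (Cmod (z ^ S n) < 1) by (apply Cmod_pow_S_lt_1, Hz).
    assert (H1 := Cmod_ge_0 (z ^ S n)); assert (H2 := Cmod_ge_0 (X ^ 2)).
    rewrite Cmod_mult; nra. }
  assert (H30 := Cmod_ge_0 (1 + X - X ^ 2 * z ^ S n)).
  unfold gauss_majorant.
  change ((2 / (1 - Cmod z)) ^ S n) with (2 / (1 - Cmod z) * (2 / (1 - Cmod z)) ^ n).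
  apply Rle_trans with (Cmod z ^ (S n * S n) * 1 * (2 / (1 - Cmod z)) ^ n * 3).
  - assert (HzX : 0 <= Cmod z ^ (S n * S n) * Cmod X ^ S n) by (apply Rmult_le_pos; lra).
    apply Rmult_le_compat; [apply Rmult_le_pos; lra|lra| |lra].
    apply Rmult_le_compat; [lra|lra| |lra].
    apply Rmult_le_compat; lra.
  - replace (3 * _) with (Cmod z ^ (S n * S n) * (2 / (1 - Cmod z) * (2 / (1 - Cmod z)) ^ n) * 3)
      by ring.
    apply Rmult_le_compat_r; [lra|].
    rewrite Rmult_1_r; apply Rmult_le_compat_l; [lra|].
    rewrite <- (Rmult_1_l ((2 / (1 - Cmod z)) ^ n)) at 1.
    apply Rmult_le_compat_r; assumption.
Qed.

(** Both factors added at step n have modulus at most 1 + |z|^n <= exp(|z|^n); the exponents add up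
    to a geometric sum, which the induction keeps exact. *)
Lemma gauss_prod_bound (z : C) (n : nat) :
  Cmod z < 1 -> Cmod (gauss_prod z n) <= exp (2 / (1 - Cmod z)).
Proof.
  intros Hz; assert (Hz0 := Cmod_ge_0 z).
  assert (H : Cmod (gauss_prod z n) <= exp (2 * (1 - Cmod z ^ n) / (1 - Cmod z))).
  { induction n as [|n IH].
    - simpl; rewrite Cmod_1.
      replace (2 * (1 - 1) / (1 - Cmod z)) with 0 by (field; lra).
      rewrite exp_0; lra.
    - change (gauss_prod z (S n))
        with (gauss_prod z n * ((1 - z ^ (2 * n + 1)) * (1 - z ^ S n)))%C.
      rewrite !Cmod_mult.
      replace (2 * (1 - Cmod z ^ S n) / (1 - Cmod z))
        with (2 * (1 - Cmod z ^ n) / (1 - Cmod z) + (Cmod z ^ n + Cmod z ^ n))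
        by (simpl; field; lra).
      rewrite !exp_plus.
      assert (Hn := pow_in_unit_interval (Cmod z) n ltac:(lra)).
      assert (Hexp := exp_ineq1_le (Cmod z ^ n)).
      assert (H1 : Cmod (1 - z ^ (2 * n + 1)) <= exp (Cmod z ^ n)).
      { apply Rle_trans with (1 := Cmod_minus_le _ _).
        rewrite Cmod_1, Cmod_pow.
        replace (2 * n + 1)%nat with (n + (n + 1))%nat by lia; rewrite pow_add.
        assert (Hn1 := pow_in_unit_interval (Cmod z) (n + 1) ltac:(lra)).
        nra. }
      assert (H2 : Cmod (1 - z ^ S n) <= exp (Cmod z ^ n)).
      { apply Rle_trans with (1 := Cmod_minus_le _ _).
        rewrite Cmod_1, Cmod_pow; simpl; nra. }
      apply Rmult_le_compat; [apply Cmod_ge_0| |exact IH|].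
      + apply Rmult_le_pos; apply Cmod_ge_0.
      + apply Rmult_le_compat; try apply Cmod_ge_0; assumption. }
  apply Rle_trans with (1 := H).
  assert (Hn := pow_in_unit_interval (Cmod z) n ltac:(lra)).
  assert (Hle : 2 * (1 - Cmod z ^ n) / (1 - Cmod z) <= 2 / (1 - Cmod z)).
  { unfold Rdiv; apply Rmult_le_compat_r; [|lra].
    apply Rlt_le, Rinv_0_lt_compat; lra. }
  destruct Hle as [Hlt|Heq]; [apply Rlt_le, exp_increasing, Hlt|rewrite Heq; lra].
Qed.

(** Each of the m applications of the functional equation costs one remainder, multiplied by a
    partial product that is bounded uniformly. *)
Lemma gauss_iterate (z : C) (n m : nat) :
  Cmod z < 1 ->
  Cmod (Csum (gauss_term z 1) n - gauss_prod z m * Csum (gauss_term z (z ^ m)) n)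
  <= INR m * (exp (2 / (1 - Cmod z)) * (3 * gauss_majorant (Cmod z) (S n))).
Proof.
  intros Hz; induction m as [|m IH].
  - simpl; replace (_ - _)%C with (RtoC 0) by ring; rewrite Cmod_0; lra.
  - assert (HX : Cmod (z ^ m) <= 1).
    { rewrite Cmod_pow; apply pow_in_unit_interval; assert (H := Cmod_ge_0 z); lra. }
    assert (H := gauss_remainder_bound z (z ^ m) n Hz HX).
    assert (Hp := gauss_prod_bound z m Hz).
    change (gauss_prod z (S m))
      with (gauss_prod z m * ((1 - z ^ (2 * m + 1)) * (1 - z ^ S m)))%C.
    replace (z ^ m * z)%C with (z ^ S m)%C in H by (simpl; ring).
    replace ((z ^ m) ^ 2 * z)%C with (z ^ (2 * m + 1))%C in H
      by (rewrite Cpow_add_r, Nat.mul_comm, Cpow_mult_r; ring).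
    replace (_ - _)%C with
      ((Csum (gauss_term z 1) n - gauss_prod z m * Csum (gauss_term z (z ^ m)) n)
       + gauss_prod z m * (Csum (gauss_term z (z ^ m)) n
         - (1 - z ^ (2 * m + 1)) * (1 - z ^ S m) * Csum (gauss_term z (z ^ S m)) n))%C
      by ring.
    apply Rle_trans with (1 := Cmod_triangle _ _).
    rewrite S_INR, Rmult_plus_distr_r, Rmult_1_l.
    apply Rplus_le_compat; [exact IH|].
    rewrite Cmod_mult; apply Rmult_le_compat; try apply Cmod_ge_0; assumption.
Qed.

Lemma gauss_term_bound (z X : C) (r : nat) :
  Cmod z < 1 -> Cmod X <= 1 ->
  Cmod (gauss_term z X r) <= Cmod X ^ r * (2 * gauss_majorant (Cmod z) r).
Proof.
  intros Hz HX; unfold gauss_term.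
  rewrite !Cmod_mult, Cmod_m1_pow, !Cmod_pow, Rmult_1_l.
  assert (HX2 := Cmod_sqr_le_1 X HX).
  assert (Hz0 := Cmod_ge_0 z); assert (HX0 := Cmod_ge_0 X).
  assert (HK := gauss_ratio_ge_1 (Cmod z) ltac:(lra)).
  assert (Hw : Cmod (Cqratio (X ^ 2) z r
            + match r with O => 0 | S r' => X * Cqratio (X ^ 2) z r' end)
          <= 2 * (2 / (1 - Cmod z)) ^ r).
  { apply Rle_trans with (1 := Cmod_triangle _ _).
    assert (Hg := Cqratio_bound (X ^ 2) z r HX2 Hz).
    destruct r as [|r]; [rewrite Cmod_0; simpl in *; lra|].
    assert (Hg' := Cqratio_bound (X ^ 2) z r HX2 Hz).
    assert (Hg0 := Cmod_ge_0 (Cqratio (X ^ 2) z r)).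
    rewrite Cmod_mult.
    change ((2 / (1 - Cmod z)) ^ S r) with (2 / (1 - Cmod z) * (2 / (1 - Cmod z)) ^ r) in *.
    assert (Cmod X * Cmod (Cqratio (X ^ 2) z r) <= (2 / (1 - Cmod z)) ^ r) by nra.
    nra. }
  apply Rle_trans with
    (Cmod z ^ (r * r) * Cmod X ^ r * (2 * (2 / (1 - Cmod z)) ^ r)).
  - apply Rmult_le_compat_l; [|exact Hw].
    apply Rmult_le_pos; apply pow_le; assumption.
  - unfold gauss_majorant; right; ring.
Qed.

Lemma gauss_sum_near_1 (z X : C) (n : nat) :
  Cmod z < 1 -> Cmod X <= 1 ->
  Cmod (Csum (gauss_term z X) n - 1)
  <= Cmod X * (2 * sum_f_R0 (gauss_majorant (Cmod z)) n).
Proof.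
  intros Hz HX; assert (HX0 := Cmod_ge_0 X); assert (Hz0 := Cmod_ge_0 z).
  induction n as [|n IH].
  - replace (Csum (gauss_term z X) 0 - 1)%C with (RtoC 0)
      by (unfold gauss_term; simpl; ring).
    rewrite Cmod_0; simpl.
    assert (H := gauss_majorant_ge_0 (Cmod z) 0 ltac:(lra)); nra.
  - rewrite Csum_S.
    replace (_ - _)%C with ((Csum (gauss_term z X) n - 1) + gauss_term z X (S n))%C by ring.
    apply Rle_trans with (1 := Cmod_triangle _ _).
    rewrite tech5, !Rmult_plus_distr_l.
    apply Rplus_le_compat; [exact IH|].
    apply Rle_trans with (1 := gauss_term_bound z X (S n) Hz HX).
    assert (H := gauss_majorant_ge_0 (Cmod z) (S n) ltac:(lra)).
    apply Rmult_le_compat_r; [lra|].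
    assert (H1 := pow_in_unit_interval (Cmod X) n ltac:(lra)).
    simpl; nra.
Qed.

(** The truncation order and the number of iterations are set equal. The n accumulated remainders
    still tend to 0 by the quadratic exponent, and the sum left at X = z^n is within a multiple of
    |z|^n of 1. No prior convergence of the product is assumed. *)
Lemma gauss_limit (z : C) :
  Cmod z < 1 ->
  is_lim_seq (fun n => Cmod (Csum (gauss_phi_term z) n - gauss_prod z n)) 0.
Proof.
  intros Hz; assert (Hz0 := Cmod_ge_0 z).
  set (rho := Cmod z) in *.
  set (B := exp (2 / (1 - rho))).
  assert (HB : 0 < B) by apply exp_pos.
  assert (HK := gauss_ratio_ge_1 rho ltac:(lra)).
  assert (Hex : ex_series (gauss_majorant rho)) by (apply ex_series_pow_sqr; lra).
  assert (Hex2 : ex_series (fun n => rho ^ (n * n) * (2 * (2 / (1 - rho))) ^ n))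
    by (apply ex_series_pow_sqr; lra).
  set (M := Series (gauss_majorant rho)).
  assert (HM : forall n, sum_f_R0 (gauss_majorant rho) n <= M).
  { intros n; rewrite <- sum_n_Reals.
    apply (is_lim_seq_incr_compare _ _ (Series_correct _ Hex)).
    intros k; rewrite sum_Sn; unfold plus; simpl.
    assert (H := gauss_majorant_ge_0 rho (S k) ltac:(lra)); lra. }
  apply is_lim_seq_le_le with (fun _ => 0)
    (fun n => B * 3 * (rho ^ (S n * S n) * (2 * (2 / (1 - rho))) ^ S n)
              + rho ^ n * (B * (2 * M))).
  - intros n; split; [apply Cmod_ge_0|].
    rewrite <- gauss_term_at_1 by exact Hz.
    replace (_ - _)%C with
      ((Csum (gauss_term z 1) n - gauss_prod z n * Csum (gauss_term z (z ^ n)) n)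
       + gauss_prod z n * (Csum (gauss_term z (z ^ n)) n - 1))%C by ring.
    apply Rle_trans with (1 := Cmod_triangle _ _).
    apply Rplus_le_compat.
    + apply Rle_trans with (1 := gauss_iterate z n n Hz).
      fold rho; fold B; unfold gauss_majorant.
      rewrite (Rpow_mult_distr 2).
      (* The count n is absorbed by doubling the geometric base, so the bound is again a term of a
         summable series. *)
      assert (HI : INR n <= 2 ^ S n).
      { apply Rle_trans with (2 ^ n); [|simpl; assert (0 < 2 ^ n) by (apply pow_lt; lra); lra].
        apply Rlt_le, (Rle_lt_trans _ (INR n)); [lra|].
        replace 2 with (INR 2) by (simpl; ring); rewrite <- pow_INR; apply lt_INR.
        apply Nat.pow_gt_lin_r; lia. }
      assert (0 <= rho ^ (S n * S n) * (2 / (1 - rho)) ^ S n)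
        by (apply Rmult_le_pos; apply pow_le; lra).
      assert (0 <= B * (rho ^ (S n * S n) * (2 / (1 - rho)) ^ S n)) by nra.
      nra.
    + assert (HX : Cmod (z ^ n) <= 1).
      { rewrite Cmod_pow; apply pow_in_unit_interval; unfold rho in *; lra. }
      assert (H1 := gauss_sum_near_1 z (z ^ n) n Hz HX).
      assert (H2 := gauss_prod_bound z n Hz).
      fold rho in H1, H2; fold B in H2.
      rewrite Cmod_mult.
      apply Rle_trans with (B * (rho ^ n * (2 * M))); [|right; ring].
      apply Rmult_le_compat; try apply Cmod_ge_0; [exact H2|].
      apply Rle_trans with (1 := H1).
      rewrite Cmod_pow; fold rho.
      apply Rmult_le_compat_l; [apply pow_le; lra|].
      specialize (HM n); lra.
  - apply is_lim_seq_const.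
  - replace (Finite 0) with (Finite (B * 3 * 0 + 0 * (B * (2 * M)))) by (f_equal; ring).
    apply is_lim_seq_plus'; apply is_lim_seq_mult'; try apply is_lim_seq_const.
    + apply -> (is_lim_seq_incr_1 (fun n => rho ^ (n * n) * (2 * (2 / (1 - rho))) ^ n)).
      apply ex_series_lim_0, Hex2.
    + apply is_lim_seq_geom; rewrite Rabs_pos_eq; lra.
Qed.

(** * Limits of complex sequences *)

Definition is_lim_Cseq (u : nat -> C) (l : C) : Prop :=
  is_lim_seq (fun n => Cmod (u n - l)) 0.

Lemma is_lim_Cseq_ext (u v : nat -> C) (l : C) :
  (forall n, u n = v n) -> is_lim_Cseq u l -> is_lim_Cseq v l.
Proof. intros E; apply is_lim_seq_ext; intros n; rewrite E; reflexivity. Qed.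

Lemma is_lim_Cseq_le (u : nat -> C) (l : C) (e : nat -> R) :
  (forall n, Cmod (u n - l) <= e n) -> is_lim_seq e 0 -> is_lim_Cseq u l.
Proof.
  intros H He; apply is_lim_seq_le_le with (fun _ => 0) e; [|apply is_lim_seq_const|exact He].
  intros n; split; [apply Cmod_ge_0|apply H].
Qed.

Lemma is_lim_Cseq_const (a : C) : is_lim_Cseq (fun _ => a) a.
Proof.
  apply is_lim_Cseq_le with (fun _ => 0); [|apply is_lim_seq_const].
  intros n; replace (a - a)%C with (RtoC 0) by ring; rewrite Cmod_0; lra.
Qed.

Lemma is_lim_seq_plus_0 (u v : nat -> R) :
  is_lim_seq u 0 -> is_lim_seq v 0 -> is_lim_seq (fun n => u n + v n) 0.
Proof.
  intros Hu Hv; replace (Finite 0) with (Finite (0 + 0)) by (f_equal; ring).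
  apply is_lim_seq_plus'; assumption.
Qed.

Lemma is_lim_Cseq_plus (u v : nat -> C) (a b : C) :
  is_lim_Cseq u a -> is_lim_Cseq v b -> is_lim_Cseq (fun n => u n + v n)%C (a + b)%C.
Proof.
  intros Hu Hv; refine (is_lim_Cseq_le _ _ _ _ (is_lim_seq_plus_0 _ _ Hu Hv)).
  intros n; replace (u n + v n - (a + b))%C with ((u n - a) + (v n - b))%C by ring.
  apply Cmod_triangle.
Qed.

Lemma is_lim_Cseq_mult (u v : nat -> C) (a b : C) :
  is_lim_Cseq u a -> is_lim_Cseq v b -> is_lim_Cseq (fun n => u n * v n)%C (a * b)%C.
Proof.
  intros Hu Hv.
  apply is_lim_Cseq_le with (fun n => Cmod (u n - a) * Cmod (v n - b)
      + (Cmod (u n - a) * Cmod b + Cmod a * Cmod (v n - b))).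
  - intros n.
    replace (u n * v n - a * b)%C
      with ((u n - a) * (v n - b) + ((u n - a) * b + a * (v n - b)))%C by ring.
    rewrite <- !Cmod_mult.
    apply Rle_trans with (1 := Cmod_triangle _ _), Rplus_le_compat_l, Cmod_triangle.
  - apply is_lim_seq_plus_0; [|apply is_lim_seq_plus_0].
    + replace (Finite 0) with (Finite (0 * 0)) by (f_equal; ring).
      apply is_lim_seq_mult'; assumption.
    + replace (Finite 0) with (Finite (0 * Cmod b)) by (f_equal; ring).
      apply is_lim_seq_mult'; [assumption|apply is_lim_seq_const].
    + replace (Finite 0) with (Finite (Cmod a * 0)) by (f_equal; ring).
      apply is_lim_seq_mult'; [apply is_lim_seq_const|assumption].
Qed.

Lemma is_lim_Cseq_unique (u : nat -> C) (a b : C) :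
  is_lim_Cseq u a -> is_lim_Cseq u b -> a = b.
Proof.
  intros Ha Hb.
  assert (H : is_lim_seq (fun _ => Cmod (a - b)) 0).
  { apply is_lim_seq_le_le with (fun _ => 0) (fun n => Cmod (u n - a) + Cmod (u n - b)).
    - intros n; split; [apply Cmod_ge_0|].
      rewrite <- (Cmod_opp (u n - a)).
      replace (a - b)%C with (- (u n - a) + (u n - b))%C by ring.
      apply Cmod_triangle.
    - apply is_lim_seq_const.
    - apply is_lim_seq_plus_0; assumption. }
  apply is_lim_seq_unique in H; rewrite Lim_seq_const in H.
  apply Rbar_finite_eq in H; apply Cmod_eq_0 in H.
  replace a with (a - b + b)%C by ring; rewrite H; ring.
Qed.

Lemma is_lim_Cseq_RtoC (u : nat -> R) (l : R) :
  is_lim_seq u l -> is_lim_Cseq (fun n => RtoC (u n)) (RtoC l).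
Proof.
  intros H; apply is_lim_Cseq_le with (fun n => Rabs (u n - l)).
  - intros n; rewrite <- RtoC_minus, Cmod_R; lra.
  - apply -> is_lim_seq_abs_0.
    replace (Finite 0) with (Finite (l - l)) by (f_equal; ring).
    apply is_lim_seq_minus'; [exact H|apply is_lim_seq_const].
Qed.

Lemma is_lim_Cseq_subseq (u : nat -> C) (l : C) (f : nat -> nat) :
  (forall n, (f n < f (S n))%nat) -> is_lim_Cseq u l -> is_lim_Cseq (fun n => u (f n)) l.
Proof.
  intros Hf H; apply (is_lim_seq_subseq (fun n => Cmod (u n - l)) 0 f); [|exact H].
  apply eventually_subseq; exact Hf.
Qed.

(** * The cubic theta identity *)

Definition Cf15_term (z : C) (r : nat) : C :=
  ((-1) ^ r * (1 - z ^ (2 * r + 1)) * z ^ (3 * (r * r) + 2 * r))%C.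

Fixpoint Cf15_sum (z : C) (n : nat) : C :=
  match n with O => 0 | S n' => Cf15_sum z n' + Cf15_term z n' end%C.

(** The cut at index 3n contains the multiples 0, 3, ..., 3n, hence n + 1 terms, and n pairs 3m + 1,
    3m + 2; therefore [Cf15_sum] excludes its upper index while [Csum] includes it. The pair has
    opposite signs and exponents differing by 6m + 3, which produces the factor 1 - z^(6m+3). *)
Lemma phi_trisection (z : C) (n : nat) :
  Csum (gauss_phi_term z) (3 * n)
  = (Csum (gauss_phi_term (z ^ 9)) n - 2 * z * Cf15_sum (z ^ 3) n)%C.
Proof.
  induction n as [|n IH]; [simpl; ring|].
  replace (3 * S n)%nat with (S (S (S (3 * n)))) by lia.
  rewrite !Csum_S.
  cbn [Cf15_sum]; rewrite IH.
  unfold gauss_phi_term, Cf15_term.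
  rewrite <- !Cpow_mult_r.
  replace (S (3 * n) * S (3 * n))%nat with (9 * (n * n) + 6 * n + 1)%nat by lia.
  replace (S (S (3 * n)) * S (S (3 * n)))%nat with (9 * (n * n) + 12 * n + 4)%nat by lia.
  replace (3 * (2 * n + 1))%nat with (6 * n + 3)%nat by lia.
  replace (3 * (3 * (n * n) + 2 * n))%nat with (9 * (n * n) + 6 * n)%nat by lia.
  replace (9 * (S n * S n))%nat with (S (S (S (3 * n))) * S (S (S (3 * n))))%nat by lia.
  rewrite !(Cpow_S (-1)).
  replace ((-1) ^ (3 * n))%C with ((-1) ^ n)%C.
  2: { rewrite Cpow_mult_r; f_equal; simpl; ring. }
  replace (9 * (n * n) + 12 * n + 4)%nat with (9 * (n * n) + 6 * n + (6 * n + 3) + 1)%nat by lia.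
  rewrite !(Cpow_add_r z (_ + _)), !Cpow_1_r.
  generalize (z ^ (S (S (S (3 * n))) * S (S (S (3 * n)))))%C (z ^ (6 * n + 3))%C; intros A B.
  rewrite ?Cpow_add_r.
  ring.
Qed.

Definition omega : C := (- (1/2), sqrt 3 / 2).

Lemma omega_sqr : (omega * omega = -1 - omega)%C.
Proof.
  assert (H := sqrt_sqrt 3 ltac:(lra)).
  unfold omega, Cmult, Cminus, Cplus, Copp, RtoC; simpl; f_equal; field_simplify; nra.
Qed.

Lemma omega_cube : (omega ^ 3 = 1)%C.
Proof.
  replace (omega ^ 3)%C with (omega * (omega * omega))%C by (simpl; ring).
  rewrite omega_sqr.
  replace (omega * (-1 - omega))%C with (- omega - omega * omega)%C by ring.
  rewrite omega_sqr; ring.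
Qed.

Lemma Cmod_omega : Cmod omega = 1.
Proof.
  unfold Cmod, omega; simpl.
  replace (_ + _) with 1; [apply sqrt_1|].
  assert (H := sqrt_sqrt 3 ltac:(lra)); nra.
Qed.

Lemma cube_roots_factor (y : C) :
  ((1 - y) * (1 - omega * y) * (1 - omega ^ 2 * y) = 1 - y ^ 3)%C.
Proof.
  replace ((1 - y) * (1 - omega * y) * (1 - omega ^ 2 * y))%C
    with (1 - (1 + omega + omega * omega) * y
          + (omega + omega * omega + omega ^ 3) * y ^ 2 - omega ^ 3 * y ^ 3)%C by ring.
  rewrite omega_cube, omega_sqr; ring.
Qed.

Lemma cube_roots_sum (x y : C) :
  ((x + y) * (x + omega * y) * (x + omega ^ 2 * y) = x ^ 3 + y ^ 3)%C.
Proof.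
  replace ((x + y) * (x + omega * y) * (x + omega ^ 2 * y))%C
    with (x ^ 3 + (1 + omega + omega * omega) * x ^ 2 * y
          + (omega + omega * omega + omega ^ 3) * x * y ^ 2 + omega ^ 3 * y ^ 3)%C by ring.
  rewrite omega_cube, omega_sqr; ring.
Qed.

Lemma omega_pow_3 (m : nat) : (omega ^ (3 * m) = 1)%C.
Proof. rewrite Cpow_mult_r, omega_cube; apply Cpow_1_l. Qed.

(** For j prime to 3, raising to the power j fixes or swaps the two primitive cube roots of unity,
    so the three factors are those of [cube_roots_factor] at y = z^j. *)
Lemma cube_roots_factor_pow (z : C) (j : nat) :
  j mod 3 <> 0%nat ->
  ((1 - z ^ j) * (1 - (omega * z) ^ j) * (1 - (omega ^ 2 * z) ^ j) = 1 - (z ^ 3) ^ j)%C.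
Proof.
  intros Hj.
  rewrite <- Cpow_mult_r, (Nat.mul_comm 3), Cpow_mult_r, <- cube_roots_factor.
  rewrite !Cpow_mult_l, <- (Cpow_mult_r omega 2).
  assert (Hd := Nat.div_mod_eq j 3); assert (Hr := Nat.mod_upper_bound j 3 ltac:(lia)).
  set (m := (j / 3)%nat) in *.
  assert (Hcases : j = (3 * m + 1)%nat \/ j = (3 * m + 2)%nat) by lia.
  destruct Hcases as [E|E].
  - replace (omega ^ j)%C with omega
      by (rewrite E, Cpow_add_r, omega_pow_3; ring).
    replace (omega ^ (2 * j))%C with (omega ^ 2)%C; [reflexivity|].
    replace (2 * j)%nat with (3 * (2 * m) + 2)%nat by lia.
    rewrite Cpow_add_r, omega_pow_3; ring.
  - replace (omega ^ j)%C with (omega ^ 2)%C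
      by (rewrite E, Cpow_add_r, omega_pow_3; ring).
    replace (omega ^ (2 * j))%C with omega; [ring|].
    replace (2 * j)%nat with (3 * (2 * m + 1) + 1)%nat by lia.
    rewrite Cpow_add_r, omega_pow_3; ring.
Qed.

Lemma omega_mult_pow_3 (z : C) (m : nat) : ((omega * z) ^ (3 * m) = (z ^ 3) ^ m)%C.
Proof. rewrite Cpow_mult_l, omega_pow_3, Cpow_mult_r; ring. Qed.

Lemma omega2_mult_pow_3 (z : C) (m : nat) : ((omega ^ 2 * z) ^ (3 * m) = (z ^ 3) ^ m)%C.
Proof.
  rewrite Cpow_mult_l, <- Cpow_mult_r, (Cpow_mult_r z).
  replace (2 * (3 * m))%nat with (3 * (2 * m))%nat by lia.
  rewrite omega_pow_3; ring.
Qed.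

Lemma gauss_prod_triple (z : C) (n : nat) :
  gauss_prod z (3 * S n)
  = (gauss_prod z (3 * n) * ((1 - z ^ (6 * n + 1)) * (1 - z ^ (3 * n + 1))
     * (1 - z ^ (6 * n + 5)) * (1 - z ^ (3 * n + 2))
     * ((1 - z ^ (3 * (2 * n + 1))) * (1 - z ^ (3 * S n)))))%C.
Proof.
  replace (3 * S n)%nat with (S (S (S (3 * n)))) by lia.
  cbn [gauss_prod].
  replace (2 * (3 * n) + 1)%nat with (6 * n + 1)%nat by lia.
  replace (2 * S (3 * n) + 1)%nat with (3 * (2 * n + 1))%nat by lia.
  replace (2 * S (S (3 * n)) + 1)%nat with (6 * n + 5)%nat by lia.
  replace (3 * n + 1)%nat with (S (3 * n)) by lia.
  replace (3 * n + 2)%nat with (S (S (3 * n))) by lia.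
  generalize (z ^ (6 * n + 1))%C (z ^ (6 * n + 5))%C (z ^ (3 * (2 * n + 1)))%C
    (z ^ S (3 * n))%C (z ^ S (S (3 * n)))%C (z ^ S (S (S (3 * n))))%C (gauss_prod z (3 * n)).
  intros; ring.
Qed.

(** Factors with exponent prime to 3 merge into factors in z^3. Those with exponent divisible by 3
    agree in all three products and give the cube on the right. The merged factors lack the
    multiples of 3 in [gauss_prod (z ^ 3) (3 * n)], and these are supplied by
    [gauss_prod (z ^ 9) n]. *)
Lemma gauss_prod_cube_roots (z : C) (n : nat) :
  (gauss_prod z (3 * n) * gauss_prod (omega * z) (3 * n) * gauss_prod (omega ^ 2 * z) (3 * n)
   * gauss_prod (z ^ 9) n
   = gauss_prod (z ^ 3) (3 * n) * gauss_prod (z ^ 3) n ^ 3)%C.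
Proof.
  induction n as [|n IH]; [simpl; ring|].
  rewrite !gauss_prod_triple.
  rewrite !omega_mult_pow_3, !omega2_mult_pow_3, !(Cpow_mult_r z 3).
  cbn [gauss_prod].
  rewrite !(Cpow_mult_r (z ^ 3) 3).
  replace ((z ^ 3) ^ 3)%C with (z ^ 9)%C by (rewrite <- Cpow_mult_r; reflexivity).
  assert (H1 := cube_roots_factor_pow z (6 * n + 1)
    ltac:(replace (6 * n + 1)%nat with (1 + 2 * n * 3)%nat by lia;
          rewrite Nat.Div0.mod_add; discriminate)).
  assert (H2 := cube_roots_factor_pow z (3 * n + 1)
    ltac:(replace (3 * n + 1)%nat with (1 + n * 3)%nat by lia;
          rewrite Nat.Div0.mod_add; discriminate)).
  assert (H3 := cube_roots_factor_pow z (6 * n + 5)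
    ltac:(replace (6 * n + 5)%nat with (2 + (2 * n + 1) * 3)%nat by lia;
          rewrite Nat.Div0.mod_add; discriminate)).
  assert (H4 := cube_roots_factor_pow z (3 * n + 2)
    ltac:(replace (3 * n + 2)%nat with (2 + n * 3)%nat by lia;
          rewrite Nat.Div0.mod_add; discriminate)).
  rewrite <- H1, <- H2, <- H3, <- H4; clear H1 H2 H3 H4.
  set (P9 := ((1 - (z ^ 9) ^ (2 * n + 1)) * (1 - (z ^ 9) ^ S n))%C).
  set (P3 := ((1 - (z ^ 3) ^ (2 * n + 1)) * (1 - (z ^ 3) ^ S n))%C).
  match goal with |- (?A1 * (?a * ?b * ?c * ?d * _) * (?A2 * (?e * ?f * ?g * ?h * _))
      * (?A3 * (?i * ?j * ?k * ?l * _)) * (?A4 * _) = _)%C =>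
    transitivity ((A1 * A2 * A3 * A4) * ((a * e * i) * (b * f * j) * (c * g * k) * (d * h * l))
      * P3 ^ 3 * P9)%C; [generalize a b c d e f g h i j k l; intros; ring|] end.
  rewrite IH; ring.
Qed.

Lemma RtoC_phi_sum (y : R) (n : nat) :
  RtoC (sum_f_R0 (phi_term y) n) = Csum (gauss_phi_term (RtoC y)) n.
Proof.
  induction n as [|n IH]; [reflexivity|].
  rewrite tech5, RtoC_plus, IH.
  rewrite Csum_S; f_equal.
  unfold phi_term, gauss_phi_term.
  rewrite !RtoC_mult, !RtoC_pow; reflexivity.
Qed.

Lemma RtoC_f15_sum (y : R) (n : nat) :
  RtoC (sum_f_R0 (f15_term y) n) = Cf15_sum (RtoC y) (S n).
Proof.
  assert (H : forall r, RtoC (f15_term y r) = Cf15_term (RtoC y) r).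
  { intros r; unfold f15_term, Cf15_term.
    rewrite !RtoC_mult, RtoC_minus, !RtoC_pow; reflexivity. }
  induction n as [|n IH].
  - simpl sum_f_R0; rewrite H; cbn [Cf15_sum]; ring.
  - rewrite tech5, RtoC_plus, IH, H; reflexivity.
Qed.

Lemma ex_series_phi_term (y : R) : Rabs y < 1 -> ex_series (phi_term y).
Proof.
  intros hy; assert (H0 := Rabs_pos y).
  apply (@ex_series_le R_AbsRing R_CompleteNormedModule _
    (fun n => 2 * (Rabs y ^ (n * n) * 1 ^ n))).
  2: { apply ex_series_Rmult, ex_series_pow_sqr; lra. }
  intros n; unfold norm; simpl; unfold abs; simpl.
  destruct n as [|n]; [simpl; rewrite Rabs_R1; lra|].
  unfold phi_term.
  rewrite !Rabs_mult, pow_1_abs, <- RPow_abs, pow1, (Rabs_pos_eq 2); lra.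
Qed.

Lemma ex_series_f15_term (q : R) : Rabs q < 1 -> ex_series (f15_term q).
Proof.
  intros hq.
  apply ex_series_ext with (fun r => (1 - q) * cf_term q q r).
  - intros r; apply cf_term_at_q, hq.
  - apply ex_series_Rmult, ex_series_cf_term; lra.
Qed.

Lemma is_lim_Cseq_phi (y : R) :
  Rabs y < 1 -> is_lim_Cseq (Csum (gauss_phi_term (RtoC y))) (RtoC (phi y)).
Proof.
  intros hy; apply is_lim_Cseq_ext with (1 := RtoC_phi_sum y).
  apply is_lim_Cseq_RtoC, is_lim_seq_partial_sums, ex_series_phi_term, hy.
Qed.

Lemma is_lim_Cseq_f15 (q : R) :
  Rabs q < 1 -> is_lim_Cseq (Cf15_sum (RtoC q)) (RtoC (f15 q)).
Proof.
  intros hq; apply is_lim_seq_incr_1.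
  apply is_lim_Cseq_ext with (1 := RtoC_f15_sum q).
  apply is_lim_Cseq_RtoC, is_lim_seq_partial_sums, ex_series_f15_term, hq.
Qed.

(** Apart from the explicit factor z, the trisected sums depend on z only through z^3. One statement
    thus serves c, omega c and omega^2 c, and the limit needs only real theta series. *)
Lemma is_lim_Cseq_phi_trisection (c : R) (z : C) :
  Rabs c < 1 -> (z ^ 3 = RtoC c ^ 3)%C ->
  is_lim_Cseq (fun n => Csum (gauss_phi_term z) (3 * n))
    (phi (c ^ 9) - 2 * z * f15 (c ^ 3))%C.
Proof.
  intros hc Hz.
  apply is_lim_Cseq_ext with
    (fun n => Csum (gauss_phi_term (RtoC (c ^ 9))) n + (- 2 * z) * Cf15_sum (RtoC (c ^ 3)) n)%C.
  - intros n; rewrite phi_trisection.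
    replace (z ^ 9)%C with (RtoC (c ^ 9)).
    2: { rewrite RtoC_pow; change 9%nat with (3 * 3)%nat.
         rewrite !Cpow_mult_r, Hz; reflexivity. }
    rewrite Hz, <- RtoC_pow; ring.
  - replace (phi (c ^ 9) - 2 * z * f15 (c ^ 3))%C
      with (phi (c ^ 9) + (- 2 * z) * f15 (c ^ 3))%C by ring.
    apply is_lim_Cseq_plus; [apply is_lim_Cseq_phi, Rabs_pow_S_lt_1, hc|].
    apply is_lim_Cseq_mult; [apply is_lim_Cseq_const|].
    apply is_lim_Cseq_f15, Rabs_pow_S_lt_1, hc.
Qed.

Lemma is_lim_Cseq_gauss_prod (z l : C) (f : nat -> nat) :
  Cmod z < 1 -> (forall n, (f n < f (S n))%nat) ->
  is_lim_Cseq (fun n => Csum (gauss_phi_term z) (f n)) l ->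
  is_lim_Cseq (fun n => gauss_prod z (f n)) l.
Proof.
  intros Hz Hf Hl.
  assert (H := is_lim_seq_subseq _ 0 f (eventually_subseq f Hf) (gauss_limit z Hz)).
  refine (is_lim_Cseq_le _ _ _ _ (is_lim_seq_plus_0 _ _ H Hl)).
  intros n.
  rewrite <- (Cmod_opp (_ - gauss_prod z (f n))).
  replace (gauss_prod z (f n) - l)%C
    with (- (Csum (gauss_phi_term z) (f n) - gauss_prod z (f n))
          + (Csum (gauss_phi_term z) (f n) - l))%C by ring.
  apply Cmod_triangle.
Qed.

Lemma phi_trisection_real (c : R) :
  Rabs c < 1 -> phi c = phi (c ^ 9) - 2 * c * f15 (c ^ 3).
Proof.
  intros hc; apply RtoC_inj.
  rewrite RtoC_minus, !RtoC_mult.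
  apply is_lim_Cseq_unique with (fun n => Csum (gauss_phi_term (RtoC c)) (3 * n)).
  - apply is_lim_Cseq_subseq with (f := fun n => (3 * n)%nat); [intros; lia|].
    apply is_lim_Cseq_phi, hc.
  - apply (is_lim_Cseq_phi_trisection c (RtoC c)); [exact hc|reflexivity].
Qed.

Lemma phi_quartic (c : R) :
  Rabs c < 1 ->
  (phi (c ^ 9) ^ 3 - 8 * c ^ 3 * f15 (c ^ 3) ^ 3) * phi (c ^ 9) = phi (c ^ 3) ^ 4.
Proof.
  intros hc.
  assert (Hid : forall n, (3 * n < 3 * S n)%nat) by (intros; lia).
  assert (Hc : Cmod c < 1) by (rewrite Cmod_R; exact hc).
  assert (Hc1 : Cmod (omega * c) < 1) by (rewrite Cmod_mult, Cmod_omega; lra).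
  assert (Hc2 : Cmod (omega ^ 2 * c) < 1)
    by (rewrite Cmod_mult, Cmod_pow, Cmod_omega, pow1; lra).
  assert (L0 := is_lim_Cseq_gauss_prod _ _ (fun n => (3 * n)%nat) Hc Hid
    (is_lim_Cseq_phi_trisection c (RtoC c) hc eq_refl)).
  assert (L1 := is_lim_Cseq_gauss_prod _ _ (fun n => (3 * n)%nat) Hc1 Hid
    (is_lim_Cseq_phi_trisection c (omega * c)%C hc
      ltac:(rewrite Cpow_mult_l, omega_cube; ring))).
  assert (L2 := is_lim_Cseq_gauss_prod _ _ (fun n => (3 * n)%nat) Hc2 Hid
    (is_lim_Cseq_phi_trisection c (omega ^ 2 * c)%C hc
      ltac:(rewrite Cpow_mult_l, <- Cpow_mult_r; change (2 * 3)%nat with (3 * 2)%nat;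
            rewrite omega_pow_3; ring))).
  assert (Lprod : forall k, is_lim_Cseq (gauss_prod (RtoC (c ^ S k))) (phi (c ^ S k))).
  { intros k; assert (Hk := Rabs_pow_S_lt_1 c k hc).
    apply (is_lim_Cseq_gauss_prod _ _ (fun n => n)).
    - rewrite Cmod_R; exact Hk.
    - intros; lia.
    - apply is_lim_Cseq_phi, Hk. }
  assert (L9 := Lprod 8%nat); assert (L3 := Lprod 2%nat).
  assert (L33 := is_lim_Cseq_subseq _ _ (fun n => (3 * n)%nat) Hid L3).
  assert (LHS := is_lim_Cseq_mult _ _ _ _
    (is_lim_Cseq_mult _ _ _ _ (is_lim_Cseq_mult _ _ _ _ L0 L1) L2) L9).
  assert (RHS := is_lim_Cseq_mult _ _ _ _ L33
    (is_lim_Cseq_mult _ _ _ _ L3 (is_lim_Cseq_mult _ _ _ _ L3 L3))).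
  assert (E : forall n, (gauss_prod (RtoC (c ^ 3)) (3 * n)
      * (gauss_prod (RtoC (c ^ 3)) n * (gauss_prod (RtoC (c ^ 3)) n * gauss_prod (RtoC (c ^ 3)) n))
    = gauss_prod c (3 * n) * gauss_prod (omega * c) (3 * n) * gauss_prod (omega ^ 2 * c) (3 * n)
      * gauss_prod (RtoC (c ^ 9)) n)%C).
  { intros n; rewrite !(RtoC_pow c), gauss_prod_cube_roots; ring. }
  assert (Eq := is_lim_Cseq_unique _ _ _ LHS (is_lim_Cseq_ext _ _ _ E RHS)).
  apply RtoC_inj.
  rewrite RtoC_mult, RtoC_minus, !RtoC_mult, !(RtoC_pow (phi _)), !(RtoC_pow (f15 _)).
  rewrite (RtoC_pow c 3).
  replace (phi (c ^ 3) ^ 4)%C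
    with (phi (c ^ 3) * (phi (c ^ 3) * (phi (c ^ 3) * phi (c ^ 3))))%C by ring.
  etransitivity; [|exact Eq].
  (* The three trisections differ only in the cube root of unity attached to y = -2 c f15(c^3), so
     their product is x^3 + y^3 with x = phi(c^9). *)
  f_equal.
  transitivity (RtoC (phi (c ^ 9)) ^ 3 + (- 2 * c * f15 (c ^ 3)) ^ 3)%C; [ring|].
  rewrite <- cube_roots_sum; ring.
Qed.

(** * Real cube roots and the final elimination *)

Lemma cbrt_cube (x : R) : cbrt x ^ 3 = x.
Proof.
  assert (H : forall y, 0 < y -> Rpower y (1/3) ^ 3 = y).
  { intros y Hy; rewrite <- Rpower_pow by apply exp_pos.
    rewrite Rpower_mult; replace (1/3 * INR 3) with 1 by (simpl; field).
    apply Rpower_1, Hy. }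
  unfold cbrt; destruct (Rlt_dec 0 x) as [H1|H1]; [apply H, H1|].
  destruct (Rlt_dec x 0) as [H2|H2]; [|simpl; lra].
  replace ((- Rpower (- x) (1/3)) ^ 3) with (- Rpower (- x) (1/3) ^ 3) by ring.
  rewrite H by lra; ring.
Qed.

Lemma cube_inj (x y : R) : x ^ 3 = y ^ 3 -> x = y.
Proof.
  intros H.
  assert (E : (x - y) * ((x + y / 2) ^ 2 + 3 / 4 * y ^ 2) = 0).
  { transitivity (x ^ 3 - y ^ 3); [field|lra]. }
  destruct (Rmult_integral _ _ E) as [E1|E1]; [lra|].
  assert (H1 := pow2_ge_0 (x + y / 2)); assert (H2 := pow2_ge_0 y).
  assert (Hy : y ^ 2 = 0) by lra; assert (Hx : (x + y / 2) ^ 2 = 0) by lra.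
  assert (y = 0) by nra; assert (x + y / 2 = 0) by nra; lra.
Qed.

Lemma cbrt_of_cube (x : R) : cbrt (x ^ 3) = x.
Proof. apply cube_inj, cbrt_cube. Qed.

Lemma Rabs_cbrt_lt_1 (x : R) : Rabs x < 1 -> Rabs (cbrt x) < 1.
Proof.
  intros H; rewrite <- (cbrt_cube x), <- RPow_abs in H.
  destruct (Rlt_le_dec (Rabs (cbrt x)) 1) as [Hlt|Hge]; [exact Hlt|].
  assert (H1 := pow_R1_Rle _ 3 Hge); lra.
Qed.

Theorem theorem2p2 (q : R) (hq : Rabs q < 1) :
  (V q) ^ 3 =
  V (q ^ 3) * (1 - V (q ^ 3) + (V (q ^ 3)) ^ 2)
    / (1 + 2 * V (q ^ 3) + 4 * (V (q ^ 3)) ^ 2).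
Proof.
  assert (hq3 := Rabs_pow_S_lt_1 q 2 hq).
  destruct (cf_value_theta q hq) as [Ha Eq1].
  destruct (cf_value_theta (q ^ 3) hq3) as [Hb Eq3].
  assert (I1 := phi_quartic (cbrt q) (Rabs_cbrt_lt_1 q hq)).
  replace (cbrt q ^ 9) with ((cbrt q ^ 3) ^ 3) in I1 by ring.
  rewrite cbrt_cube in I1.
  assert (I2 := phi_quartic q hq).
  assert (I3 := phi_trisection_real q hq).
  rewrite <- pow_mult in Hb, Eq3; simpl Nat.mul in Hb, Eq3.
  unfold V; rewrite cbrt_of_cube, Eq1, Eq3, Rpow_mult_distr, cbrt_cube.
  rewrite I3 in I1; clear I3 Eq1 Eq3.
  revert Ha Hb I1 I2.
  generalize (phi (q ^ 3)) (phi (q ^ 9)) (f15 q) (f15 (q ^ 3)); intros a b s t Ha Hb I1 I2.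
  (* With v = V q and w = V (q^3): 1 - 2w = phi(q)/phi(q^9), 1 - 8v^3 = (phi(q)/phi(q^3))^4
     and 1 - 8w^3 = (phi(q^3)/phi(q^9))^4, so (1 - 8v^3)(1 - 8w^3) = (1 - 2w)^4. *)
  set (w := q * (t / b)).
  assert (Ew : q * t = w * b) by (unfold w; field; exact Hb).
  assert (Hden : 0 < 1 + 2 * w + 4 * w ^ 2) by (assert (H := pow2_ge_0 (1 + 4 * w)); nra).
  assert (J2 : a ^ 4 = b ^ 4 * ((1 - 2 * w) * (1 + 2 * w + 4 * w ^ 2))).
  { rewrite <- I2.
    transitivity (b ^ 4 - 8 * (q * t) ^ 3 * b); [ring|rewrite Ew; ring]. }
  assert (J1 : a ^ 4 - 8 * (q * s ^ 3) * a = b ^ 4 * (1 - 2 * w) ^ 4).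
  { transitivity ((b - 2 * (q * t)) ^ 4); [|rewrite Ew; ring].
    transitivity ((a ^ 3 - 8 * q * s ^ 3) * a); [ring|rewrite I1; ring]. }
  assert (Ha4 : a ^ 4 <> 0) by (apply pow_nonzero; exact Ha).
  transitivity (8 * (q * s ^ 3) * a / (8 * a ^ 4)); [field; exact Ha|].
  replace (8 * (q * s ^ 3) * a) with (a ^ 4 - b ^ 4 * (1 - 2 * w) ^ 4) by lra.
  rewrite J2 in *.
  (* By [J2] this factor divides a^4, so it cannot vanish and may be cancelled. *)
  assert (1 - 2 * w <> 0) by (intros E; apply Ha4; rewrite E; ring).
  (* After cancelling b^4 (1 - 2w), the numerator (1 + 2w + 4w^2) - (1 - 2w)^3 equals 8w(1 - w +
     w^2). *)
  field; repeat split; lra.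
Qed.
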